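(* Let $k\ge 1$ and let $X$ be a finite $k$-step nilspace. Let $\mathcal{P}(|X|)$ be the set of primes dividing $|X|$. Then $X$ is isomorphic (as a nilspace) to a product nilspace $\prod_{p\in\mathcal{P}(|X|)}X_p$, where $X_p$ is a $k$-step $p$-nilspace for each $p\in\mathcal{P}(|X|)$. Moreover, this decomposition is unique up to isomorphism, i.e. if also $X\cong\prod_{p\in\mathcal{P}(|X|)}Y_p$ with each $Y_p$ a $k$-step $p$-nilspace, then $X_p\cong Y_p$ for every $p\in\mathcal{P}(|X|)$.
   Context: A morphism $\{0,1\}^m\to\{0,1\}^n$ of discrete cubes is the restriction of an affine homomorphism $\mathbb{Z}^m\to\mathbb{Z}^n$. A nilspace is a non-empty set $X$ with sets $C^n(X)\subset X^{\{0,1\}^n}$ ($n\ge 0$), whose elements are called $n$-cubes, such that: (composition) if $c\in C^n(X)$ and $\theta:\{0,1\}^m\to\{0,1\}^n$ is a morphism then $c\circ\theta\in C^m(X)$; (ergodicity) $C^0(X)=X$ and $C^1(X)=X^{\{0,1\}}$; (corner completion) if $c':\{0,1\}^n\setminus\{1^n\}\to X$ restricts to an $(n-1)$-cube on each $(n-1)$-face containing $0^n$, then $c'$ extends to some $c\in C^n(X)$. $X$ is $k$-step if this extension is always unique for $n=k+1$. A morphism of nilspaces is a map $\phi:X\to Y$ with $\phi\circ c\in C^n(Y)$ for all $n$ and $c\in C^n(X)$; an isomorphism is a bijective morphism whose inverse is a morphism. Cubes on a product nilspace are the maps each of whose components is a cube. For an abelian group $A$ and $\ell\ge1$, $\mathcal{D}_\ell(A)$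 is the nilspace on $A$ where $c:\{0,1\}^n\to A$ is a cube iff $\sum_{v\in\{0,1\}^{\ell+1}}(-1)^{|v|}c(\theta(v))=0$ for every morphism $\theta:\{0,1\}^{\ell+1}\to\{0,1\}^n$, where $|v|$ is the number of coordinates of $v$ equal to 1. For a $k$-step nilspace $X$, write $x\sim_i y$ if there are $c,c'\in C^{i+1}(X)$ with $c(0^{i+1})=x$, $c'(0^{i+1})=y$ and $c(v)=c'(v)$ for $v\ne 0^{i+1}$; then $X_i:=X/\sim_i$, with the images of the cubes of $X$, is an $i$-step nilspace ($X_0$ is a point, $X_k=X$). For $1\le i\le k$ the $i$-th structure group $Z_i(X)$ is the abelian group acting on $X_i$, simply transitively on each fibre of the projection $X_i\to X_{i-1}$, such that if $c\in C^n(X_i)$ and $c':\{0,1\}^n\to X_i$ have the same projection to $X_{i-1}$, then $c'\in C^n(X_i)$ iff the map $c'-c:\{0,1\}^n\to Z_i(X)$ is a cube on $\mathcal{D}_i(Z_i(X))$. A $k$-step nilspace is a $p$-nilspace ($p$ prime) if each of its structure groups is a $p$-group. An empty product is the one-point nilspace. *)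

(* Defs.v *)
From mathcomp Require Import all_boot all_order all_algebra.
From mathcomp Require Import boolp.

Set Implicit Arguments.
Unset Strict Implicit.
Unset Printing Implicit Defensive.

Import GRing.Theory.
Local Open Scope ring_scope.

Definition dcube (n : nat) := {ffun 'I_n -> bool}.

Definition vertex0 n : dcube n := [ffun => false].
Definition vertex1 n : dcube n := [ffun => true].

Definition dcube_embed n (v : dcube n) : 'rV[int]_n := \row_i (v i)%:Z.

Definition dcube_morphism m n (theta : dcube m -> dcube n) : Prop :=
  exists (g : {additive 'rV[int]_m -> 'rV[int]_n}) (b : 'rV[int]_n),
    forall v, dcube_embed (theta v) = g (dcube_embed v) + b.

Definition weight n (v : dcube n) : nat := #|[pred i | v i]|.

(* The (n-1)-face {v | v i = 0}, parametrized by {0,1}^(n-1). *)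
Definition lower_face n (i : 'I_n) (v : dcube n.-1) : dcube n :=
  [ffun j => if unlift i j is Some j' then v j' else false].

Record cubespace := Cubespace {
  carrier :> Type;
  cubes : forall n, (dcube n -> carrier) -> Prop }.

Arguments Cubespace {carrier} cubes.
Arguments cubes X {n} c : rename.

(* A corner is a map on {0,1}^n minus 1^n; it is given here by an arbitrary
   total map, whose value at 1^n is never used.  As nilspaces are non-empty,
   every partial map arises in this way. *)
Definition corner (X : cubespace) n (c' : dcube n -> X) : Prop :=
  forall i : 'I_n, cubes X (c' \o lower_face i).

Definition completes (X : cubespace) n (c' c : dcube n -> X) : Prop :=
  cubes X c /\ forall v, v != vertex1 n -> c v = c' v.

Record is_nilspace (X : cubespace) : Prop := IsNilspace {
  nil_nonempty : inhabited X;
  nil_comp : forall m n (c : dcube n -> X) (theta : dcube m -> dcube n),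
    cubes X c -> dcube_morphism theta -> cubes X (c \o theta);
  nil_ergodic0 : forall c : dcube 0 -> X, cubes X c;
  nil_ergodic1 : forall c : dcube 1 -> X, cubes X c;
  nil_corner : forall n (c' : dcube n -> X),
    corner c' -> exists c, completes c' c }.

Definition is_step_nilspace (k : nat) (X : cubespace) : Prop :=
  is_nilspace X /\
  forall c' : dcube k.+1 -> X, corner c' -> exists! c, completes c' c.

Definition nil_morphism (X Y : cubespace) (phi : X -> Y) : Prop :=
  forall n (c : dcube n -> X), cubes X c -> cubes Y (phi \o c).

Definition nil_isomorphic (X Y : cubespace) : Prop :=
  exists (phi : X -> Y) (psi : Y -> X),
    [/\ cancel phi psi, cancel psi phi, nil_morphism phi & nil_morphism psi].

Definition prod_cubespace (I : Type) (X : I -> cubespace) : cubespace :=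
  @Cubespace (forall i, X i)
    (fun n c => forall i, cubes (X i) (fun v => c v i)).

Definition Dspace (l : nat) (A : zmodType) : cubespace :=
  @Cubespace A (fun n c =>
    forall theta : dcube l.+1 -> dcube n, dcube_morphism theta ->
      \sum_(v : dcube l.+1) c (theta v) *~ (-1) ^+ weight v = 0).

Definition nil_sim (X : cubespace) (i : nat) (x y : X) : Prop :=
  exists c c' : dcube i.+1 -> X,
    [/\ cubes X c, cubes X c', c (vertex0 _) = x, c' (vertex0 _) = y
      & forall v, v != vertex0 _ -> c v = c' v].

(* X / ~_i as the set of classes [x] = {y | x ~_i y}. *)
Definition nil_quot (X : cubespace) (i : nat) : Type :=
  {A : X -> Prop | exists x, A = nil_sim i x}.

Definition nil_class (X : cubespace) (i : nat) (x : X) : nil_quot X i :=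
  exist _ (nil_sim i x) (ex_intro _ x erefl).

Definition factor (X : cubespace) (i : nat) : cubespace :=
  @Cubespace (nil_quot X i) (fun n c =>
    exists2 c0 : dcube n -> X, cubes X c0 & c = @nil_class X i \o c0).

(* The projection X_i -> X_j (j <= i), computed on a chosen representative;
   on a nilspace ~_i refines ~_j, so the choice is immaterial. *)
Definition factor_proj (X : cubespace) (i j : nat) (a : factor X i) :
    factor X j :=
  nil_class j (sval (cid (svalP a))).

(* A, acting by act on X_i, is the i-th structure group Z_i(X) (for i > 0).
   In sg_cubes, d is the difference c' - c. *)
Record is_structure_group (X : cubespace) (i : nat) (A : zmodType)
    (act : factor X i -> A -> factor X i) : Prop := IsStructureGroup {
  sg_act0 : forall x, act x 0 = x;
  sg_actD : forall x a b, act x (a + b) = act (act x a) b;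
  sg_fibre : forall x a, factor_proj i.-1 (act x a) = factor_proj i.-1 x;
  sg_simply_transitive : forall x y,
    factor_proj i.-1 x = factor_proj i.-1 y -> exists! a, act x a = y;
  sg_cubes : forall n (c c' : dcube n -> factor X i) (d : dcube n -> A),
    cubes (factor X i) c ->
    (forall v, factor_proj i.-1 (c v) = factor_proj i.-1 (c' v)) ->
    (forall v, c' v = act (c v) (d v)) ->
    (cubes (factor X i) c' <-> cubes (Dspace i A) d) }.

Definition is_pgroup (p : nat) (A : zmodType) : Prop :=
  forall a : A, exists n : nat, a *+ (p ^ n) = 0.

(* Structure groups of a nilspace exist and are unique up to isomorphism, so
   it does not matter which realization of Z_i(X) is tested. *)
Definition is_step_pnilspace (k p : nat) (X : cubespace) : Prop :=
  is_step_nilspace k X /\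
  forall i, (1 <= i <= k)%N ->
    exists (A : zmodType) (act : factor X i -> A -> factor X i),
      is_structure_group act /\ is_pgroup p A.

Definition prime_divisor (n : nat) := {p : nat | p \in primes n}.

(* Main.v *)
(** Induction on the step.  If the (k-1)-step factor of X is U * V with |U| and |V|
   coprime, then X is an extension of U * V by its top structure group A, given by a
   cocycle rho (the alternating sum, over a cube, of an A-valued coordinate), and A is
   the sum of its pi-part and its pi'-part.  The pi-part of rho has values on which |V|
   is invertible: averaging it over the neighbours of a cube in V makes it cohomologous
   to a cocycle depending on U only, and symmetrically for the other part, so that X
   itself splits.  Averages make sense because the number of completions of a corner
   only depends on its dimension and divides the number of points.
   For uniqueness, a morphism from a finite p-nilspace to a q-nilspace with p <> q is
   constant, again by averaging: its components in the structure groups of the target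
   are polynomial, and their top-degree differences vanish. *)

Require Import Defs.
From HB Require Import structures.
From mathcomp Require Import all_boot all_order all_fingroup all_algebra.
From mathcomp Require Import cyclic pgroup boolp.

Set Implicit Arguments.
Unset Strict Implicit.
Unset Printing Implicit Defensive.

Import GRing.Theory.
Local Open Scope ring_scope.

(** * Discrete cubes *)

(** Averaging over all neighbours in [U * V] would need [|U|] to be invertible on the values as
    well. It is therefore carried out in [V] alone, above one point of [U] at a time. What is left
    is a cocycle vanishing on the cubes that are constant in [U]; that it does not see the
    [V]-coordinate is a separate argument, by descending induction on the number of directions in
    which the [U]-cube is constant. That argument and the constancy of morphisms rest on one fact: a
    function of cubes that is additive in one direction, takes equal values on neighbours, and has
    torsion values of order prime to the number of points, is zero. Classes of [~_i] are predicates,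
    so factors are replaced by isomorphic models on finite types before anything is counted.
    Structure groups have to be built: the top one consists of translations. Orders and structure
    groups are tied together by the fact that the order of a finite nilspace is the product of the
    orders of its structure groups. *)

Definition coordwise m n (theta : dcube m -> dcube n) : Prop :=
  forall j, (exists b, forall v, theta v j = b) \/
            (exists i b, forall v, theta v j = v i (+) b).

(** A flipped coordinate is [1 - x], whence the entry [-1] of the matrix and the translation by
    [1]. *)
Lemma coordwise_morphism m n (theta : dcube m -> dcube n) :
  coordwise theta -> dcube_morphism theta.
Proof.
move=> cw.
have [f fP] : {f : 'I_n -> option 'I_m * bool & forall j v,
    theta v j = if (f j).1 is Some i then v i (+) (f j).2 else (f j).2}.
  apply: (@choice _ _ (fun j p => forall v,
    theta v j = if p.1 is Some i then v i (+) p.2 else p.2)) => j.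
  by case: (cw j) => [[b bP]|[i [b bP]]]; [exists (None, b)|exists (Some i, b)].
pose M : 'M[int]_(m, n) := \matrix_(i, j)
  (if (f j).1 == Some i then if (f j).2 then -1 else 1 else 0).
exists (mulmxr M), (\row_j ((f j).2)%:Z) => v.
apply/rowP => j; rewrite !mxE fP.
case E: (f j) => [[i|] b] /=; last first.
  by rewrite big1 ?add0r // => i _; rewrite !mxE E /= mulr0.
rewrite (bigD1 i) //= !mxE E /= eqxx big1 ?addr0.
  by case: (v i); case: b {E}; rewrite //= ?mulr0 ?mulr1 ?add0r ?subrr ?mulrN1 ?addNr ?addr0.
move=> i' ni; rewrite !mxE E /=; case: eqP => [[e]|]; rewrite ?mulr0 //.
by rewrite e eqxx in ni.
Qed.

Definition ins n (i : 'I_n.+1) (b : bool) (v : dcube n) : dcube n.+1 :=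
  [ffun j => if unlift i j is Some j' then v j' else b].

Definition del n (i : 'I_n.+1) (v : dcube n.+1) : dcube n :=
  [ffun j => v (lift i j)].

Definition glue (X : Type) n (i : 'I_n.+1) (a b : dcube n -> X) : dcube n.+1 -> X :=
  fun v => if v i then b (del i v) else a (del i v).

Lemma ins_same n (i : 'I_n.+1) b v : ins i b v i = b.
Proof. by rewrite ffunE unlift_none. Qed.

Lemma ins_lift n (i : 'I_n.+1) b v j : ins i b v (lift i j) = v j.
Proof. by rewrite ffunE liftK. Qed.

Lemma insK n (i : 'I_n.+1) b : cancel (ins i b) (del i).
Proof. by move=> v; apply/ffunP => j; rewrite ffunE ins_lift. Qed.

Lemma delK n (i : 'I_n.+1) (v : dcube n.+1) : ins i (v i) (del i v) = v.
Proof.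
apply/ffunP => j; case: (unliftP i j) => [j'|] ->.
  by rewrite ins_lift ffunE.
by rewrite ins_same.
Qed.

Lemma glue_ins X n (i : 'I_n.+1) (a b : dcube n -> X) e v :
  glue i a b (ins i e v) = if e then b v else a v.
Proof. by rewrite /glue ins_same insK. Qed.

Lemma glue_faces X n (i : 'I_n.+1) (c : dcube n.+1 -> X) :
  glue i (c \o ins i false) (c \o ins i true) = c.
Proof.
apply: funext => v; rewrite /glue /= -{4}(delK i v).
by case: (v i).
Qed.

Lemma lower_face_ins n (i : 'I_n.+1) : lower_face i = ins i false.
Proof. by []. Qed.

Lemma comp_glue X Y n (i : 'I_n.+1) (f : X -> Y) (a b : dcube n -> X) :
  f \o glue i a b = glue i (f \o a) (f \o b).
Proof. by apply: funext => v; rewrite /glue /=; case: (v i). Qed.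

Ltac cw_coord i b := right; exists i, b => ?; rewrite ?ffunE ?addbF ?addbT //.

Lemma ins_coordwise n (i : 'I_n.+1) b : coordwise (ins i b).
Proof.
move=> j; case: (unliftP i j) => [j'|] ->.
  by right; exists j', false => v; rewrite ins_lift addbF.
by left; exists b => v; rewrite ins_same.
Qed.

Lemma del_coordwise n (i : 'I_n.+1) : coordwise (@del n i).
Proof. by move=> j; cw_coord (lift i j) false. Qed.

Lemma coordwise_comp l m n (f : dcube m -> dcube n) (g : dcube l -> dcube m) :
  coordwise f -> coordwise g -> coordwise (f \o g).
Proof.
move=> cf cg j; case: (cf j) => [[b bP]|[i [b bP]]].
  by left; exists b => v /=.
case: (cg i) => [[b' bP']|[i' [b' bP']]].
  by left; exists (b' (+) b) => v /=; rewrite bP bP'.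
by right; exists i', (b' (+) b) => v /=; rewrite bP bP' addbA.
Qed.

Definition setc n (i : 'I_n) (b : bool) (v : dcube n) : dcube n :=
  [ffun j => if j == i then b else v j].

Lemma setc_coordwise n (i : 'I_n) b : coordwise (setc i b).
Proof.
move=> j; case: (eqVneq j i) => [->|ne].
  by left; exists b => v; rewrite ffunE eqxx.
by right; exists j, false => v; rewrite ffunE (negbTE ne) addbF.
Qed.

Definition xorc n (w v : dcube n) : dcube n := [ffun j => v j (+) w j].

Lemma xorc_coordwise n (w : dcube n) : coordwise (xorc w).
Proof. by move=> j; right; exists j, (w j) => v; rewrite ffunE. Qed.

Lemma xorcK n (w : dcube n) : involutive (xorc w).
Proof. by move=> v; apply/ffunP => j; rewrite !ffunE -addbA addbb addbF. Qed.

Definition meetc n (u v : dcube n) : dcube n := [ffun j => v j && u j].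

Lemma meetc_coordwise n (u : dcube n) : coordwise (meetc u).
Proof.
move=> j; case E: (u j).
  by right; exists j, false => v; rewrite ffunE E addbF andbT.
by left; exists false => v; rewrite ffunE E andbF.
Qed.

Definition upd (X : Type) n (c : dcube n -> X) (w : dcube n) (y : X) : dcube n -> X :=
  fun v => if v == w then y else c v.

Lemma upd_same X n (c : dcube n -> X) w : upd c w (c w) = c.
Proof. by apply: funext => v; rewrite /upd; case: eqP => [->|]. Qed.

Lemma upd_upd X n (c : dcube n -> X) w x y : upd (upd c w x) w y = upd c w y.
Proof. by apply: funext => v; rewrite /upd; case: eqP. Qed.

Lemma upd_at X n (c : dcube n -> X) w x : upd c w x w = x.
Proof. by rewrite /upd eqxx. Qed.

Definition lec n (v u : dcube n) : bool := [forall j, v j ==> u j].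

Lemma lecP n (v u : dcube n) : reflect (forall j, v j -> u j) (lec v u).
Proof. by apply: (iffP forallP) => h j; apply/implyP; apply: h. Qed.

Lemma lec_meet n (v u : dcube n) : lec v u = (meetc u v == v).
Proof.
apply/lecP/eqP => [h|<- j]; last by rewrite ffunE => /andP[].
by apply/ffunP => j; rewrite ffunE; case E: (v j); rewrite ?(h _ E).
Qed.

Lemma meetcc n (u : dcube n) : meetc u u = u.
Proof. by apply/ffunP => j; rewrite ffunE andbb. Qed.

Lemma meetc_le n (u v : dcube n) : lec (meetc u v) u.
Proof. by apply/lecP => j; rewrite ffunE => /andP[]. Qed.

Lemma lec_vertex1 n (v : dcube n) : lec v (vertex1 n).
Proof. by apply/lecP => j _; rewrite ffunE. Qed.

Lemma meetc1 n (v : dcube n) : meetc (vertex1 n) v = v.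
Proof. by apply/eqP; rewrite -lec_meet lec_vertex1. Qed.

Lemma weight_lec n (v u : dcube n) : lec v u -> v != u -> (weight v < weight u)%N.
Proof.
move=> /lecP le ne; rewrite /weight; apply: proper_card; apply/properP; split.
  by apply/fintype.subsetP => j; rewrite !inE; apply: le.
case: (pickP [pred j | u j && ~~ v j]) => [j /= /andP[uj vj]|no].
  by exists j; rewrite !inE.
case/eqP: ne; apply/ffunP => j; move: (no j) (le j) => /=.
by case: (v j); case: (u j) => // _ h; rewrite h.
Qed.

Lemma weight_ins n (i : 'I_n.+1) b (v : dcube n) : weight (ins i b v) = (b + weight v)%N.
Proof.
rewrite /weight -!sum1_card [LHS]big_mkcond [in RHS]big_mkcond /= (bigD1_ord i) //=.
rewrite inE ins_same; congr (_ + _)%N.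
by apply: eq_bigr => j _; rewrite !inE ins_lift.
Qed.

Section Sums.
Variable A : zmodType.

Definition csum n (g : dcube n -> A) : A := \sum_v g v *~ (-1) ^+ weight v.

Lemma sum_dcubeS n (i : 'I_n.+1) (g : dcube n.+1 -> A) :
  \sum_v g v = \sum_v g (ins i false v) + \sum_v g (ins i true v).
Proof.
rewrite (bigID (fun v : dcube n.+1 => v i)) /= addrC; congr (_ + _).
- rewrite (reindex (ins i false)) /=.
    by apply: eq_bigl => v; rewrite ins_same.
  exists (del i) => v; first by rewrite insK.
  by rewrite unfold_in /= => /negbTE vi; rewrite -{2}(delK i v) vi.
- rewrite (reindex (ins i true)) /=.
    by apply: eq_bigl => v; rewrite ins_same.
  exists (del i) => v; first by rewrite insK.
  by rewrite unfold_in /= => vi; rewrite -{2}(delK i v) vi.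
Qed.

Lemma csum_glue n (i : 'I_n.+1) (a b : dcube n -> A) :
  csum (glue i a b) = csum a - csum b.
Proof.
rewrite /csum (sum_dcubeS i) -sumrN; congr (_ + _); apply: eq_bigr => v _.
  by rewrite glue_ins weight_ins.
by rewrite glue_ins weight_ins exprS mulN1r mulrNz.
Qed.

Lemma csumD n (f g : dcube n -> A) : csum (fun v => f v + g v) = csum f + csum g.
Proof. by rewrite /csum -big_split; apply: eq_bigr => v _; rewrite mulrzDl. Qed.

Lemma csumB n (f g : dcube n -> A) : csum (fun v => f v - g v) = csum f - csum g.
Proof. by rewrite /csum -sumrB; apply: eq_bigr => v _; rewrite mulrzBl. Qed.

Lemma csumMn n (f : dcube n -> A) e : csum (fun v => f v *+ e) = csum f *+ e.
Proof.
rewrite /csum -sumrMnl; apply: eq_bigr => v _.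
by rewrite !pmulrn mulrzAC.
Qed.

Lemma csum_const n (x : A) : csum (fun _ : dcube n.+1 => x) = 0.
Proof.
have -> : (fun _ : dcube n.+1 => x) = glue ord0 (fun _ => x) (fun _ => x).
  by apply: funext => v; rewrite /glue; case: ifP.
by rewrite csum_glue subrr.
Qed.

Lemma csum0 (g : dcube 0 -> A) : csum g = g (vertex0 0).
Proof.
have w0 (v : dcube 0) : v = vertex0 0 by apply/ffunP => -[].
rewrite /csum (bigD1 (vertex0 0)) //= big1 ?addr0; last first.
  by move=> v; rewrite (w0 v) eqxx.
have -> : weight (vertex0 0) = 0%N by apply: eq_card0 => -[].
by rewrite expr0 mulr1z.
Qed.

End Sums.

(** * Completion and gluing of cubes *)

(** [e] parametrizes the lower face of vertices below [u] by a cube of dimension [weight u], and [r]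
    retracts onto it. Compatibility with [meetc] transfers the order, so that a corner with tip [u]
    becomes a corner in the sense of the completion axiom. *)
Lemma face_maps n (u : dcube n) :
  exists (e : dcube (weight u) -> dcube n) (r : dcube n -> dcube (weight u)),
    [/\ coordwise e, coordwise r & cancel e r] /\
    [/\ forall v, e (r v) = meetc u v, e (vertex1 _) = u
      & forall s t, e (meetc s t) = meetc (e s) (e t)].
Proof.
pose r (v : dcube n) : dcube (weight u) := [ffun t => v (enum_val t)].
pose e (t : dcube (weight u)) : dcube n :=
  [ffun j => [exists t' : 'I_(weight u), (enum_val t' == j) && t t']].
have eT j (uj : j \in [pred j | u j]) t : e t j = t (enum_rank_in uj j).
  rewrite ffunE; apply/existsP/idP => [[t' /andP[/eqP E]]|h].
    by rewrite (_ : enum_rank_in uj j = t') //; apply: enum_val_inj; rewrite enum_rankK_in ?E.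
  by exists (enum_rank_in uj j); rewrite enum_rankK_in // eqxx.
have eF j t : u j = false -> e t j = false.
  move=> uj; rewrite ffunE; apply/existsP => -[t' /andP[/eqP E _]].
  by move: (enum_valP t'); rewrite E inE uj.
exists e, r; split; split.
- move=> j; case E: (u j); last by left; exists false => v; rewrite eF.
  have uj : j \in [pred j | u j] by rewrite inE.
  by right; exists (enum_rank_in uj j), false => v; rewrite eT addbF.
- by move=> t; cw_coord (enum_val t) false.
- move=> t; apply/ffunP => t'; rewrite ffunE (eT _ (enum_valP t')).
  by rewrite enum_valK_in.
- move=> v; apply/ffunP => j; rewrite [RHS]ffunE; case E: (u j); last by rewrite eF // andbF.
  have uj : j \in [pred j | u j] by rewrite inE.
  by rewrite (eT _ uj) ffunE enum_rankK_in // andbT.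
- apply/ffunP => j; case E: (u j); last by rewrite eF.
  have uj : j \in [pred j | u j] by rewrite inE.
  by rewrite (eT _ uj) ffunE.
- move=> s t; apply/ffunP => j; rewrite [RHS]ffunE; case E: (u j); last by rewrite !eF.
  have uj : j \in [pred j | u j] by rewrite inE.
  by rewrite !(eT _ uj) ffunE.
Qed.

Lemma lower_face_coordwise n (i : 'I_n) : coordwise (lower_face i).
Proof.
move=> j; rewrite /lower_face; case E: (unlift i j) => [j'|].
  by right; exists j', false => v; rewrite ffunE E addbF.
by left; exists false => v; rewrite ffunE E.
Qed.

Section Nilspace.
Variable X : cubespace.
Hypothesis hX : is_nilspace X.

Lemma cube_comp m n (c : dcube n -> X) (theta : dcube m -> dcube n) (f : dcube m -> X) :
  cubes X c -> coordwise theta -> (forall v, f v = c (theta v)) -> cubes X f.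
Proof.
move=> cc ct /funext ->.
exact: (nil_comp hX cc (coordwise_morphism ct)).
Qed.

Lemma cube_const n (x : X) : cubes X (fun _ : dcube n => x).
Proof.
apply: (@cube_comp n 0 (fun _ => x) (fun _ => vertex0 0)) => //; last by case.
exact: nil_ergodic0.
Qed.

Lemma cube_dim0 (c : dcube 0 -> X) : cubes X c.
Proof. exact: nil_ergodic0. Qed.

Lemma cube_at_face n (u : dcube n) (e : dcube (weight u) -> dcube n)
    (r : dcube n -> dcube (weight u)) (f : dcube n -> X) :
  coordwise e -> coordwise r -> cancel e r -> (forall v, e (r v) = meetc u v) ->
  cubes X (f \o meetc u) <-> cubes X (f \o e).
Proof.
move=> ce cr K K'; split=> h.
  by apply: (cube_comp h ce) => v /=; rewrite -K' K.
by apply: (cube_comp h cr) => v /=; rewrite K'.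
Qed.

Lemma corner_at n (u : dcube n) (f : dcube n -> X) :
  (forall v, lec v u -> v != u -> cubes X (f \o meetc v)) ->
  exists y, cubes X (upd f u y \o meetc u).
Proof.
move=> h; have [e [r [[ce cr K] [K' e1 em]]]] := face_maps u.
have e_inj := can_inj K.
have [|c [cc cE]] := @nil_corner _ hX _ (f \o e).
  (* The [i]-th facet of the face below [u] consists of the vertices below [w], and [w] lies
     strictly below [u]. *)
  move=> i; pose w := e (setc i false (vertex1 _)).
  have wu : lec w u by rewrite lec_meet -K' K.
  have neq : w != u.
    rewrite -e1 (inj_eq e_inj); apply/eqP => /ffunP/(_ i).
    by rewrite !ffunE eqxx.
  apply: (cube_comp (h _ wu neq)
           (coordwise_comp ce (@lower_face_coordwise _ i))) => t /=.
  rewrite /w -em; congr (f (e _)); apply/ffunP => j; rewrite !ffunE.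
  case: eqP => [->|_]; last by rewrite andbT.
  by rewrite unlift_none.
exists (c (vertex1 _)); apply/(cube_at_face _ ce cr K K').
have -> // : upd f u (c (vertex1 _)) \o e = c.
have eu t : (e t == u) = (t == vertex1 _) by rewrite -(inj_eq e_inj) e1.
apply: funext => t /=; rewrite /upd eu.
by case: eqP => [->//|/eqP /cE ->].
Qed.

Definition downset n (D : pred (dcube n)) := forall u v, lec v u -> D u -> D v.

(** The restriction of [f] to the face below [u] is encoded as the degenerate map [f \o meetc u] on
    the whole of [{0,1}^n], so that the dimension does not vary with [u]. *)
Definition partial_cube n (D : pred (dcube n)) (f : dcube n -> X) :=
  forall u, D u -> cubes X (f \o meetc u).

Lemma partial_cube_upd n (D : pred (dcube n)) (f : dcube n -> X) u y :
  downset D -> ~~ D u -> partial_cube D f -> cubes X (upd f u y \o meetc u) ->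
  partial_cube (fun v => (v == u) || D v) (upd f u y).
Proof.
move=> dD Du pf cu u' /orP[/eqP -> //|Du'].
have -> : upd f u y \o meetc u' = f \o meetc u'; last exact: pf.
apply: funext => v /=; rewrite /upd; case: eqP => // E.
by move: Du; rewrite -E (dD _ _ (meetc_le _ _) Du').
Qed.

Lemma downset_min n (D : pred (dcube n)) : ~~ [forall v, D v] ->
  exists u, ~~ D u /\ forall v, lec v u -> v != u -> D v.
Proof.
rewrite negb_forall => /existsP[u0 nD].
case: (arg_minnP (P := fun v => ~~ D v) (@weight n) nD) => u Du umin.
exists u; split=> // v le ne; apply: contraT => /umin.
by rewrite leqNgt weight_lec.
Qed.

Lemma downsetU n (D : pred (dcube n)) u : downset D ->
  (forall v, lec v u -> v != u -> D v) -> downset (fun v => (v == u) || D v).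
Proof.
move=> dD h v w le /orP[/eqP E|Dv]; last by rewrite (dD _ _ le Dv) orbT.
rewrite E in le; case: eqP => // /eqP ne.
exact: h.
Qed.

Lemma card_downsetU n (D : pred (dcube n)) u : ~~ D u ->
  #|[pred v | ~~ D v]| = #|[pred v | ~~ ((v == u) || D v)]|.+1.
Proof.
move=> Du; rewrite (cardD1 u) inE Du add1n; congr _.+1.
by apply: eq_card => v; rewrite !inE negb_or.
Qed.

(* Greedy filling: the vertices outside a downset are completed one by one, in
   increasing order, each completion being subject to the constraint [G]. *)
Lemma extend_downset n (D : pred (dcube n)) (G : dcube n -> X -> Prop) f :
  downset D -> partial_cube D f -> (forall v, D v -> G v (f v)) ->
  (forall u g, ~~ D u ->
     (forall v, lec v u -> v != u -> G v (g v) /\ cubes X (g \o meetc v)) ->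
     exists y, G u y /\ cubes X (upd g u y \o meetc u)) ->
  exists c, [/\ cubes X c, forall v, D v -> c v = f v & forall v, G v (c v)].
Proof.
have [m] := ubnP #|[pred v | ~~ D v]|; elim: m D f => // m IH D f lt dD pf fG hext.
have [/forallP all|nall] := boolP [forall v, D v].
  exists f; split=> // [|v]; last exact: fG.
  apply: (cube_comp (pf (vertex1 _) (all _)) (xorc_coordwise (vertex0 _))) => v /=.
  by rewrite meetc1; congr (f _); apply/ffunP => j; rewrite !ffunE addbF.
have [u [Du umin]] := downset_min nall.
have [|y [Gy cy]] := hext u f Du.
  by move=> v le ne; have Dv := umin _ le ne; split; [apply: fG|apply: pf].
have [||||v g|c [cc cE cG]] := IH (fun v => (v == u) || D v) (upd f u y).
- by move: lt; rewrite (card_downsetU Du).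
- exact: downsetU.
- exact: partial_cube_upd.
- by move=> v; rewrite /upd; case: eqP => [->|_ /=]; last exact: fG.
- by rewrite negb_or => /andP[_ Dv]; apply: hext.
exists c; split=> // v Dv; rewrite cE ?Dv ?orbT // /upd; case: eqP => // E.
by rewrite -E Dv in Du.
Qed.

Lemma extend_cube n (D : pred (dcube n)) f :
  downset D -> partial_cube D f -> exists c, cubes X c /\ forall v, D v -> c v = f v.
Proof.
move=> dD pf; have [//| u g _ h | c [cc cE _]] :=
  @extend_downset n D (fun _ _ => True) f dD pf; last by exists c.
have [|y cy] := @corner_at n u g; last by exists y.
by move=> v le ne; case: (h v le ne).
Qed.

Definition nb n (a b : dcube n -> X) : Prop := cubes X (glue ord0 a b).

Lemma cube_glue_dir n (i j : 'I_n.+1) (a b : dcube n -> X) :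
  cubes X (glue i a b) -> cubes X (glue j a b).
Proof.
move=> h; apply: (cube_comp (theta := fun v => ins i (v j) (del j v)) h).
  move=> l; case: (unliftP i l) => [l'|] ->.
    by right; exists (lift j l'), false => v; rewrite ins_lift ffunE addbF.
  by right; exists j, false => v; rewrite ins_same addbF.
by move=> v; rewrite glue_ins.
Qed.

Lemma nbE n (i : 'I_n.+1) (a b : dcube n -> X) : cubes X (glue i a b) <-> nb a b.
Proof. by split; apply: cube_glue_dir. Qed.

Lemma nb_sym n (a b : dcube n -> X) : nb a b -> nb b a.
Proof.
move=> h; apply: (cube_comp (theta := xorc (ins ord0 true (vertex0 n))) h).
  exact: xorc_coordwise.
move=> v; have -> : xorc (ins ord0 true (vertex0 n)) v = ins ord0 (~~ v ord0) (del ord0 v).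
  apply/ffunP => j; rewrite ffunE; case: (unliftP ord0 j) => [l|] ->.
    by rewrite !ins_lift !ffunE addbF.
  by rewrite !ins_same addbT.
by rewrite glue_ins /glue; case: (v ord0).
Qed.

Lemma cube_ins n (i : 'I_n.+1) b (c : dcube n.+1 -> X) : cubes X c -> cubes X (c \o ins i b).
Proof. by move=> h; apply: (cube_comp h (ins_coordwise i b)). Qed.

Lemma nb_left n (a b : dcube n -> X) : nb a b -> cubes X a.
Proof.
move/(cube_ins ord0 false); suff -> : glue ord0 a b \o ins ord0 false = a by [].
by apply: funext => v /=; rewrite glue_ins.
Qed.

Lemma nb_right n (a b : dcube n -> X) : nb a b -> cubes X b.
Proof. by move/nb_sym/nb_left. Qed.

Lemma nb_refl n (a : dcube n -> X) : cubes X a -> nb a a.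
Proof.
move=> h; apply: (cube_comp h (del_coordwise ord0)) => v.
by rewrite /glue; case: ifP.
Qed.

Lemma nb_trans n (b a c : dcube n -> X) : nb a b -> nb b c -> nb a c.
Proof.
move=> hab hbc.
pose i1 : 'I_n.+2 := lift ord0 ord0.
(* The square with corners b, a, c: its antidiagonal is [a, c]. *)
pose D (v : dcube n.+2) := ~~ (v ord0 && v i1).
pose f (v : dcube n.+2) :=
  let w := del ord0 (del ord0 v) in
  if v ord0 then a w else if v i1 then c w else b w.
have [||q [cq qE]] := @extend_cube _ D f.
- move=> u v /lecP le; rewrite /D; apply: contra => /andP[v0 v1].
  by rewrite !le.
- move=> u; rewrite /D negb_and => /orP[u0|u1].
  + apply: (cube_comp (theta := del ord0 \o meetc u) hbc).
      by apply: coordwise_comp; [apply: del_coordwise|apply: meetc_coordwise].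
    move=> v; rewrite /f /glue /= !ffunE (negbTE u0) andbF.
    by [].
  + apply: (cube_comp (theta := fun v => ins ord0 (v ord0 && u ord0) (del ord0 (del ord0 (meetc u v)))) (nb_sym hab)).
      move=> l; case: (unliftP ord0 l) => [l'|] ->.
        pose L := lift (ord0 : 'I_n.+2) (lift ord0 l'); case E: (u L).
          by right; exists L, false => v; rewrite ins_lift !ffunE E andbT addbF.
        by left; exists false => v; rewrite ins_lift !ffunE E andbF.
      case E: (u ord0).
        by right; exists ord0, false => v; rewrite ins_same andbT addbF.
      by left; exists false => v; rewrite ins_same andbF.
    by move=> v; rewrite /f glue_ins /= !ffunE (negbTE u1) andbF.
pose t (v : dcube n.+1) := ins (ord0 : 'I_n.+2) (~~ v ord0) v.
have ct : coordwise t.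
  move=> l; case: (unliftP ord0 l) => [l'|] ->.
    by right; exists l', false => v; rewrite ins_lift addbF.
  by right; exists ord0, true => v; rewrite ins_same addbT.
apply: (cube_comp cq ct) => v.
have i1E : t v i1 = v ord0 by rewrite /t ins_lift.
have dE : del ord0 (t v) = v by rewrite /t insK.
rewrite qE /D; last by rewrite i1E ins_same andNb.
by rewrite /f /= i1E dE ins_same /glue; case: (v ord0).
Qed.

End Nilspace.

(** * The relations [~_i] *)

Definition mix X n (P : pred (dcube n)) (h c : dcube n -> X) : dcube n -> X :=
  fun v => if P v then h v else c v.

Definition setcs n (s : seq 'I_n) (w v : dcube n) : dcube n :=
  [ffun j => if j \in s then w j else v j].

Definition tip X n (x y : X) : dcube n -> X := upd (fun _ => x) (vertex1 n) y.

Lemma setc_ins n (j : 'I_n.+1) b b' v : setc j b (ins j b' v) = ins j b v.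
Proof.
apply/ffunP => l; rewrite ffunE; case: (unliftP j l) => [l'|] ->.
  by rewrite eq_sym (negbTE (neq_lift _ _)) !ins_lift.
by rewrite eqxx ins_same.
Qed.

Definition pad m n (b : bool) (t : dcube m) : dcube n :=
  [ffun j : 'I_n => if insub (val j) is Some j' then t j' else b].

Lemma pad_coordwise m n b : coordwise (@pad m n b).
Proof.
move=> j; case: (insubP ('I_m) (val j)) => [j' _ E|E].
  right; exists j', false => v; rewrite ffunE addbF.
  by rewrite -E valK.
by left; exists b => v; rewrite ffunE insubN.
Qed.

Lemma padE m n b (t : dcube m) (j : 'I_n) (j' : 'I_m) : val j = val j' -> pad n b t j = t j'.
Proof. by move=> E; rewrite ffunE E valK. Qed.

Lemma padK m n b b' : (m <= n)%N -> cancel (@pad m n b) (@pad n m b').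
Proof.
move=> le t; apply/ffunP => j.
by rewrite (@padE _ _ _ _ j (widen_ord le j)) // (@padE _ _ _ _ _ j).
Qed.

Lemma pad_vertex1 m n (t : dcube m) : (m <= n)%N ->
  (pad n true t == vertex1 n) = (t == vertex1 m).
Proof.
move=> le; apply/eqP/eqP => [/ffunP E|->].
  by apply/ffunP => j; move: (E (widen_ord le j)); rewrite (@padE _ _ _ _ _ j) // !ffunE.
by apply/ffunP => j; rewrite !ffunE; case: insubP => // j' _ _; rewrite ffunE.
Qed.

Section Sim.
Variable X : cubespace.
Hypothesis hX : is_nilspace X.

Lemma cube_faces n (j : 'I_n.+1) b (f : dcube n.+1 -> X) :
  cubes X f <-> nb (f \o ins j b) (f \o ins j (~~ b)).
Proof.
rewrite -{1}(glue_faces j f) (nbE hX); case: b => //=.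
by split; apply: nb_sym.
Qed.

(** The face of [mix P h c] away from [P] is an unmodified face of [c]. As the two faces of [c] are
    neighbours, transitivity allows it to be exchanged for the face of [c] on the side of [P]. *)
Lemma mix_step n (j : 'I_n) b (P : pred (dcube n)) (h c : dcube n -> X) :
  cubes X c -> (forall v, P v -> v j = b) ->
  cubes X (mix P h c) <-> cubes X (mix P h (c \o setc j b)).
Proof.
case: n j P h c => [[] //|n] j P h c cc Pj.
rewrite !(cube_faces j b).
have -> : mix P h (c \o setc j b) \o ins j b = mix P h c \o ins j b.
  by apply: funext => v; rewrite /mix /= setc_ins.
have Pn v : P (ins j (~~ b) v) = false.
  by apply/negP => /Pj; rewrite ins_same; case: b {Pj}.
have -> : mix P h (c \o setc j b) \o ins j (~~ b) = c \o ins j b.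
  by apply: funext => v; rewrite /mix /= Pn setc_ins.
have -> : mix P h c \o ins j (~~ b) = c \o ins j (~~ b).
  by apply: funext => v; rewrite /mix /= Pn.
have cn : nb (c \o ins j b) (c \o ins j (~~ b)) by move/(cube_faces j b): cc.
split=> h'; first exact: (nb_trans hX h' (nb_sym hX cn)).
exact: (nb_trans hX h' cn).
Qed.

(* Whether modifying a cube on a set [P] of vertices gives a cube only depends on
   its values after collapsing every coordinate that is constant on [P]. *)
Lemma mix_steps n (s : seq 'I_n) (w : dcube n) (P : pred (dcube n)) (h c : dcube n -> X) :
  cubes X c -> (forall j v, j \in s -> P v -> v j = w j) ->
  cubes X (mix P h c) <-> cubes X (mix P h (c \o setcs s w)).
Proof.
elim: s c => [|j s IH] c cc sP.
  have -> // : c \o setcs [::] w = c.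
  by apply: funext => v /=; congr (c _); apply/ffunP => j; rewrite ffunE.
rewrite (@mix_step _ j (w j)) //; last by move=> v; apply: sP; rewrite mem_head.
rewrite IH; last 2 first.
- exact: cube_comp cc (setc_coordwise j (w j)) _.
- by move=> l v ls; apply: sP; rewrite inE ls orbT.
suff -> : (c \o setc j (w j)) \o setcs s w = c \o setcs (j :: s) w by [].
apply: funext => v /=; congr (c _); apply/ffunP => l; rewrite !ffunE inE.
by case: eqP => [->|].
Qed.

(** All coordinates are constant on a single vertex, so [c] collapses to its value there: whether a
    change at one vertex gives a cube depends only on the old and the new value. This is what makes
    [~_i] transitive. *)
Lemma upd_cube n (c : dcube n -> X) w y : cubes X c ->
  cubes X (upd c w y) <-> cubes X (upd (fun _ => c w) w y).
Proof.
move=> cc; have := @mix_steps n (enum 'I_n) w (pred1 w) (fun _ => y) c cc.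
case=> [j v _ /eqP -> //|h1 h2].
have E : c \o setcs (enum 'I_n) w = fun _ => c w.
  by apply: funext => v /=; congr (c _); apply/ffunP => l; rewrite ffunE mem_enum.
by rewrite E in h1 h2; split.
Qed.

Lemma upd_const_move n (x y : X) (w w' : dcube n) :
  cubes X (upd (fun _ => x) w y) -> cubes X (upd (fun _ => x) w' y).
Proof.
move=> h; apply: (cube_comp hX h (xorc_coordwise (xorc w w'))) => v; rewrite /upd.
suff -> : (xorc (xorc w w') v == w) = (v == w') by [].
rewrite -(inj_eq (can_inj (xorcK (xorc w w')))) xorcK; congr (_ == _).
by apply/ffunP => j; rewrite !ffunE; case: (w j); case: (w' j).
Qed.

Lemma nil_simE i (x y : X) : nil_sim i x y <-> cubes X (@tip X i.+1 x y).
Proof.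
split=> [[c [c' [cc cc' <- <- ne]]]|h].
  apply: (@upd_const_move _ _ _ (vertex0 _)); apply/(upd_cube _ _ cc).
  suff -> : upd c (vertex0 _) (c' (vertex0 _)) = c' by [].
  by apply: funext => v; rewrite /upd; case: eqP => [->//|/eqP /ne].
exists (fun _ => x), (upd (fun _ => x) (vertex0 _) y); split=> //.
- exact: cube_const.
- exact: upd_const_move h.
- by rewrite /upd eqxx.
- by move=> v /negbTE; rewrite /upd => ->.
Qed.

Lemma cube_updE i (c : dcube i.+1 -> X) w y : cubes X c ->
  cubes X (upd c w y) <-> nil_sim i (c w) y.
Proof.
move=> cc; rewrite upd_cube // nil_simE.
by split; apply: upd_const_move.
Qed.

Lemma sim_refl i (x : X) : nil_sim i x x.
Proof. by apply/nil_simE; rewrite /tip (upd_same (fun _ => x)); apply: cube_const. Qed.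

Lemma sim_sym i (x y : X) : nil_sim i x y -> nil_sim i y x.
Proof.
by move=> [c [c' [? ? ? ? h]]]; exists c', c; split=> // v /h.
Qed.

Lemma sim_trans i (y x z : X) : nil_sim i x y -> nil_sim i y z -> nil_sim i x z.
Proof.
move=> /nil_simE hxy hyz; apply/nil_simE.
by case: (@cube_updE i _ (vertex1 _) z hxy); rewrite /tip upd_at upd_upd => _; apply.
Qed.

Lemma cube_sim_full i (c c' : dcube i.+1 -> X) :
  cubes X c -> (forall v, nil_sim i (c v) (c' v)) -> cubes X c'.
Proof.
move=> cc h.
suff H : forall s : seq (dcube i.+1), cubes X (fun v => if v \in s then c' v else c v).
  suff <- : (fun v => if v \in enum (dcube i.+1) then c' v else c v) = c' by [].
  by apply: funext => v; rewrite mem_enum.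
elim=> [//|w s IH].
suff -> : (fun v => if v \in w :: s then c' v else c v) =
          upd (fun v => if v \in s then c' v else c v) w (c' w).
  by apply/(cube_updE _ _ IH); case: ifP => // _; apply: sim_refl.
by apply: funext => v; rewrite /upd inE; case: eqP => [->|].
Qed.

Lemma cube_sim i n (c c' : dcube n -> X) : (n <= i.+1)%N ->
  cubes X c -> (forall v, nil_sim i (c v) (c' v)) -> cubes X c'.
Proof.
move=> le cc h.
have cc2 : cubes X (c' \o @pad i.+1 n false).
  apply: (@cube_sim_full _ (c \o @pad i.+1 n false)) => [|v]; last exact: h.
  exact: cube_comp cc (@pad_coordwise _ _ _) _.
apply: (cube_comp hX cc2 (@pad_coordwise _ _ false)) => v /=.
by rewrite padK.
Qed.

Lemma sim_le i j (x y : X) : (j <= i)%N -> nil_sim i x y -> nil_sim j x y.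
Proof.
move=> le h; apply/nil_simE; apply: (@cube_sim i _ (fun _ => x)) => //.
  exact: cube_const.
by move=> v; rewrite /tip /upd; case: eqP => // _; apply: sim_refl.
Qed.

Lemma sim0 (x y : X) : nil_sim 0 x y.
Proof. by apply/nil_simE; apply: nil_ergodic1. Qed.

(** Uniqueness of completion modulo [~_i]. Padding with [true] restricts to an (i+1)-dimensional
    face through [1^n], where changes at one vertex are governed by [~_i]. *)
Lemma sim_top i n (c c' : dcube n -> X) : (i < n)%N -> cubes X c -> cubes X c' ->
  (forall v, v != vertex1 n -> nil_sim i (c v) (c' v)) ->
  nil_sim i (c (vertex1 n)) (c' (vertex1 n)).
Proof.
move=> lt cc cc' h.
have top1 : @pad i.+1 n true (vertex1 _) = vertex1 n by apply/eqP; rewrite pad_vertex1.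
have pc f : cubes X f -> cubes X (f \o @pad i.+1 n true).
  by move=> cf; apply: (cube_comp hX cf (@pad_coordwise _ _ true)).
have := pc _ cc; have := pc _ cc'.
set d := c \o _; set d' := c' \o _ => cd' cd.
have cu : cubes X (upd d (vertex1 _) (d' (vertex1 _))).
  apply: (cube_sim_full cd') => v; rewrite /upd; case: eqP => [->|/eqP ne].
    exact: sim_refl.
  by apply/sim_sym/h; rewrite pad_vertex1.
by move/cube_updE: cu => /(_ cd); rewrite /d /d' /= top1.
Qed.

Lemma sim_step k (hk : forall c' : dcube k.+1 -> X, corner c' -> exists! c, completes c' c)
  (x y : X) : nil_sim k x y <-> x = y.
Proof.
split=> [h|->]; last exact: sim_refl.
have cx : cubes X (fun _ : dcube k.+1 => x) by apply: cube_const.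
have [i|c [_ cU]] := hk (fun _ => x); first exact: cube_const.
have E : @tip X k.+1 x y = fun _ => x.
  transitivity c; last by apply: cU.
  symmetry; apply: cU; split; first exact/(nil_simE k x y).
  by move=> v /negbTE; rewrite /tip /upd => ->.
by rewrite -[y](upd_at (fun _ : dcube k.+1 => x) (vertex1 _)) -[upd _ _ _]/(tip x y) E.
Qed.

Lemma step_sim k : (forall x y : X, nil_sim k x y -> x = y) -> is_step_nilspace k X.
Proof.
move=> h; split=> // c' cc'; have [c [cc cE]] := nil_corner hX cc'.
exists c; split=> // d [cd dE]; apply: funext => v.
have [->|ne] := eqVneq v (vertex1 _); last by rewrite cE ?dE.
apply: h; apply: sim_top => // w ne.
by rewrite cE ?dE //; apply: sim_refl.
Qed.

End Sim.

(** * Factors *)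

Section Factor.
Variable X : cubespace.
Hypothesis hX : is_nilspace X.
Variable i : nat.

Lemma nil_classE (x y : X) : nil_class i x = nil_class i y <-> nil_sim i x y.
Proof.
split=> [[E]|h]; first by rewrite E; apply: sim_refl.
apply: eq_exist; apply: funext => z; apply: propext; split.
  by move=> h'; apply: (sim_trans hX (sim_sym h)).
exact: (sim_trans hX h).
Qed.

Lemma nil_class_surj (z : factor X i) : exists x, nil_class i x = z.
Proof.
case: z => A hA; have [x E] := hA; exists x.
by apply: eq_exist.
Qed.

Lemma factor_lift n (c : dcube n -> factor X i) : exists f : dcube n -> X, nil_class i \o f = c.
Proof.
have [f fP] := choice (fun v => nil_class_surj (c v)).
by exists f; apply: funext.
Qed.

Lemma factor_cube n (c : dcube n -> X) : cubes X c -> cubes (factor X i) (@nil_class X i \o c).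
Proof. by move=> cc; exists c. Qed.

Lemma factor_cubeE n (c : dcube n -> X) : (n <= i.+1)%N ->
  cubes (factor X i) (@nil_class X i \o c) <-> cubes X c.
Proof.
move=> le; split=> [[c0 cc0 E]|]; last exact: factor_cube.
apply: (cube_sim hX le cc0) => v; apply/nil_classE.
by move: (congr1 (fun f => f v) E).
Qed.

(** Cubes can be lifted step by step along classes of [~_i]. Up to dimension [i + 1] being a cube
    depends on the classes only, so [c0 u] itself will do; above it any completion lands in the
    right class by [sim_top]. *)
Lemma class_fibration n (u : dcube n) (c0 f : dcube n -> X) :
  cubes X (c0 \o meetc u) ->
  (forall v, lec v u -> v != u -> nil_sim i (f v) (c0 v) /\ cubes X (f \o meetc v)) ->
  exists y, nil_sim i y (c0 u) /\ cubes X (upd f u y \o meetc u).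
Proof.
move=> cc0 h; have [e [r [[ce cr K] [K' e1 em]]]] := face_maps u.
have eu t : (e t == u) = (t == vertex1 _) by rewrite -(inj_eq (can_inj K)) e1.
have ele t : lec (e t) u by rewrite lec_meet -K' K.
have cce : cubes X (c0 \o e) by apply/(cube_at_face hX _ ce cr K K').
case: (leqP (weight u) i.+1) => [le|gt].
  exists (c0 u); split; first exact: sim_refl.
  apply/(cube_at_face hX _ ce cr K K'); apply: (cube_sim hX le cce) => t /=.
  rewrite /upd eu; case: eqP => [->|/eqP ne]; first by rewrite e1; apply: sim_refl.
  by apply: sim_sym; have [|//] := h (e t) (ele t); rewrite eu.
have [|y cy] := @corner_at X hX n u f; first by move=> v le ne; case: (h v le ne).
exists y; split=> //.
have cye : cubes X (upd f u y \o e) by apply/(cube_at_face hX _ ce cr K K').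
have := @sim_top X hX i _ _ _ (ltnW gt) cye cce.
rewrite /= e1 upd_at; apply=> t ne; rewrite /upd eu (negbTE ne).
by have [|//] := h (e t) (ele t); rewrite eu.
Qed.

(** A lift of the corner is built greedily. A vertex [u] other than [1^n] lies in some lower face,
    on which [c'] is the image of a cube [c0]; the new value is chosen in the class given by [c0].
    At [1^n] any completion is allowed. *)
Lemma factor_corner n (c' : dcube n -> factor X i) : corner c' -> exists c, completes c' c.
Proof.
move=> cc'; have [f0 f0E] := factor_lift c'.
have [|v|//|u g _ h|c [cc _ cE]] := @extend_downset X hX n pred0
  (fun v y => v != vertex1 n -> nil_class i y = c' v) f0.
- by [].
- by [].
- have [ue|ne] := eqVneq u (vertex1 n).
    have [|y cy] := @corner_at X hX n u g; last by exists y; split => // ; move=> h1; rewrite ue eqxx in h1.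
    by move=> v le ne; case: (h v le ne).
  have /existsP[j /negbTE uj] : [exists j, ~~ u j].
    move: ne; apply: contraR; rewrite negb_exists => /forallP all.
    by apply/eqP/ffunP => j; rewrite ffunE; move: (all j); rewrite negbK.
  have [c0 cc0 c0E] := cc' j.
  case: n c' cc' f0 f0E u g h ne j uj c0 cc0 c0E => [|n] c' cc' f0 f0E u g h ne j uj c0 cc0 c0E.
    by case: j uj c0E cc0.
  have c0E' v : c' (meetc u v) = nil_class i (c0 (del j (meetc u v))).
    move: (congr1 (fun f => f (del j (meetc u v))) c0E) => /= <-; congr (c' _).
    by rewrite lower_face_ins -{1}(delK j (meetc u v)) ffunE uj andbF.
  have le1 v : lec v u -> v != u -> v != vertex1 n.+1.
    move=> /lecP le _; apply/eqP => E; move: (le j); rewrite E uj ffunE.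
    by move/(_ isT).
  have [| |y [ysim cy]] := @class_fibration _ u (c0 \o (del j \o meetc u)) g.
  + apply: (cube_comp hX cc0) => [|v]; last reflexivity.
    apply: coordwise_comp (meetc_coordwise u).
    exact: coordwise_comp (del_coordwise j) (meetc_coordwise u).
  + move=> v le ne'; have [gv cg] := h v le ne'; split=> //; apply/nil_classE.
    rewrite gv ?(le1 v) //= -c0E'; congr (c' _).
    by apply/esym/eqP; rewrite -lec_meet.
  exists y; split=> // _; move/nil_classE: ysim => ->.
  by rewrite /= -c0E' meetcc.
exists (nil_class i \o c); split; first exact: factor_cube.
by move=> v ne /=; apply: cE.
Qed.

Lemma factor_nilspace : is_nilspace (factor X i).
Proof.
split.
- by have [x] := nil_nonempty hX; constructor; exact: (nil_class i x).
- move=> m n c theta [c0 cc0 ->] mt; exists (c0 \o theta) => //.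
  exact: (nil_comp hX).
- move=> c; have [f <-] := factor_lift c; apply: factor_cube.
  exact: nil_ergodic0.
- move=> c; have [f <-] := factor_lift c; apply: factor_cube.
  exact: nil_ergodic1.
- exact: factor_corner.
Qed.

Lemma factor_sim j (x y : X) : (j <= i)%N ->
  nil_sim j (nil_class i x : factor X i) (nil_class i y) <-> nil_sim j x y.
Proof.
move=> le; rewrite (nil_simE factor_nilspace) (nil_simE hX) -(@factor_cubeE j.+1) //.
suff -> : tip (nil_class i x : factor X i) (nil_class i y) = @nil_class X i \o tip x y by [].
by move=> n; apply: funext => v; rewrite /tip /upd /=; case: eqP.
Qed.

Lemma factor_step : is_step_nilspace i (factor X i).
Proof.
apply: step_sim; first exact: factor_nilspace.
move=> z w; have [x <-] := nil_class_surj z; have [y <-] := nil_class_surj w.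
by rewrite factor_sim // => h; apply/nil_classE.
Qed.

Lemma factor_projE j (x : X) : (j <= i)%N ->
  factor_proj j (nil_class i x : factor X i) = nil_class j x.
Proof.
move=> le; rewrite /factor_proj; case: cid => r /= E.
have : nil_sim i r x by rewrite -E; apply: sim_refl.
move/(sim_le hX le) => h; apply: eq_exist; apply: funext => z; apply: propext; split.
  exact: (sim_trans hX (sim_sym h)).
exact: (sim_trans hX h).
Qed.

End Factor.

Lemma factor_proj_sim X (hX : is_nilspace X) i j (z w : factor X i) : (j <= i)%N ->
  factor_proj j z = factor_proj j w <-> nil_sim j z w.
Proof.
move=> le; have [x <-] := nil_class_surj z; have [y <-] := nil_class_surj w.
by rewrite !factor_projE // factor_sim // nil_classE.
Qed.

(** * Finite models and transport along isomorphisms *)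

Lemma finite_quot (T : finType) (S : Type) (h : T -> S) :
  exists (U : finType) (q : T -> U) (r : U -> T),
    cancel r q /\ forall x y, q x = q y <-> h x = h y.
Proof.
pose rep x := odflt x [pick y | `[< h y = h x >]].
have repP x : h (rep x) = h x.
  by rewrite /rep; case: pickP => [y /asboolP|].
have repE x y : h x = h y -> rep x = rep y.
  rewrite /rep => E; rewrite E; case: pickP => [//|/(_ y) /asboolP].
  by case.
have rr x : rep (rep x) == rep x by apply/eqP/repE.
pose U := {x | rep x == x}.
exists U, (fun x => exist _ (rep x) (rr x)), val; split.
  by case=> x hx; apply: val_inj; apply/eqP.
move=> x y; split=> [[E]|E]; first by rewrite -repP E repP.
by apply: val_inj; apply: repE.
Qed.

Lemma iso_sym X Y : nil_isomorphic X Y -> nil_isomorphic Y X.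
Proof. by case=> f [g [h1 h2 h3 h4]]; exists g, f. Qed.

Lemma iso_trans Y X Z : nil_isomorphic X Y -> nil_isomorphic Y Z -> nil_isomorphic X Z.
Proof.
case=> f [g [K K' mf mg]] [f2 [g2 [K2 K2' mf2 mg2]]].
exists (f2 \o f), (g \o g2); split.
- exact: can_comp.
- exact: can_comp.
- by move=> n c /mf /mf2.
- by move=> n c /mg2 /mg.
Qed.

Lemma iso_of_bij (X Y : cubespace) (f : X -> Y) :
  injective f -> (forall y, exists x, f x = y) ->
  (forall n (c : dcube n -> X), cubes X c <-> cubes Y (f \o c)) -> nil_isomorphic X Y.
Proof.
move=> inj surj cE; have [g gP] := choice surj.
exists f, g; split=> //.
- by move=> x; apply: inj; rewrite gP.
- by move=> n c /cE.
- move=> n c cc; apply/cE; suff -> : f \o (g \o c) = c by [].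
  by apply: funext => v /=.
Qed.

Lemma iso_nilspace X Y : nil_isomorphic X Y -> is_nilspace X -> is_nilspace Y.
Proof.
case=> f [g [K K' mf mg]] hX; have cf n (c : dcube n -> Y) : f \o (g \o c) = c.
  by apply: funext => v /=.
split.
- by have [x] := nil_nonempty hX; exact: (inhabits (f x)).
- move=> m n c t /mg cc mt; rewrite -[c]cf.
  exact/mf/(nil_comp hX cc mt).
- by move=> c; rewrite -[c]cf; apply/mf/nil_ergodic0.
- by move=> c; rewrite -[c]cf; apply/mf/nil_ergodic1.
- move=> n c' cc'; have [|c [cc cE]] := @nil_corner _ hX n (g \o c').
    by move=> i; apply/mg/cc'.
  exists (f \o c); split; first exact: mf.
  by move=> v /cE /= ->.
Qed.

Lemma iso_sim (X Y : cubespace) (f : X -> Y) i x y : nil_morphism f -> nil_sim i x y -> nil_sim i (f x) (f y).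
Proof.
move=> mf [c [c' [cc cc' <- <- E]]]; exists (f \o c), (f \o c'); split=> //; try exact: mf.
by move=> v /E /= ->.
Qed.

Lemma iso_step k X Y : nil_isomorphic X Y -> is_step_nilspace k X -> is_step_nilspace k Y.
Proof.
move=> iso [hX sX]; apply: step_sim; first exact: iso_nilspace iso hX.
have [f [g [K K' mf mg]]] := iso.
move=> x y /(iso_sim mg) /(sim_step hX sX) E.
by rewrite -(K' x) E.
Qed.

Lemma finite_model (T : finType) (X : cubespace) (h : T -> X) :
  (forall x, exists t, h t = x) ->
  exists (U : finType) (C : forall n, (dcube n -> U) -> Prop),
    nil_isomorphic X (Cubespace C).
Proof.
move=> surj; have [U [q [r [K qE]]]] := finite_quot h.
exists U, (fun n c => cubes X (h \o (r \o c))).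
apply: iso_sym; apply: (@iso_of_bij (Cubespace _) _ (h \o r)) => //=.
- by move=> u v /= /qE; rewrite !K.
- by move=> x; have [t <-] := surj x; exists (q t); apply/qE; rewrite K.
Qed.

(** * The top structure group as a group of translations *)

Lemma sign_eq0 (A : zmodType) (a : A) n : a *~ (-1) ^+ n = 0 -> a = 0.
Proof.
by rewrite -signr_odd; case: odd; rewrite ?expr1 ?mulrN1z // => /eqP; rewrite oppr_eq0 => /eqP.
Qed.

(** The structure group [Z_(k+1)] of a (k+1)-step space, acting on the space itself rather than on
    [factor X k.+1]: its orbits are the classes of [~_k], and its cubes those of degree [k + 1]. *)
Record top_action (X : cubespace) k (A : zmodType) (act : X -> A -> X) : Prop := TopAction {
  ta_act0 : forall x, act x 0 = x;
  ta_actD : forall x a b, act x (a + b) = act (act x a) b;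
  ta_sim : forall x a, nil_sim k x (act x a);
  ta_transitive : forall x y, nil_sim k x y -> exists a, act x a = y;
  ta_free : forall x a b, act x a = act x b -> a = b;
  ta_cubes : forall n (c : dcube n -> X) (d : dcube n -> A), cubes X c ->
    (cubes X (fun v => act (c v) (d v)) <-> cubes (Dspace k.+1 A) d) }.

Section Translations.
Variables (X : cubespace) (k : nat).
Hypotheses (hX : is_nilspace X) (hS : forall x y : X, nil_sim k.+1 x y -> x = y).

Lemma cube_uniq (c c' : dcube k.+2 -> X) : cubes X c -> cubes X c' ->
  (forall v, v != vertex1 _ -> c v = c' v) -> c (vertex1 _) = c' (vertex1 _).
Proof.
move=> cc cc' E; apply/hS/sim_top => // v /E ->.
exact: sim_refl.
Qed.

(** By induction the lower faces of [f] are cubes, so [f] is a corner. A completion agrees with [f]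
    at [1^n] as well, because both restrict to cubes on a (k+2)-dimensional face through [1^n],
    where completion is unique. *)
Lemma cube_by_faces n (f : dcube n -> X) :
  (forall theta : dcube k.+2 -> dcube n, coordwise theta -> cubes X (f \o theta)) -> cubes X f.
Proof.
have small m (g : dcube m -> X) : (m <= k.+2)%N ->
  (forall theta : dcube k.+2 -> dcube m, coordwise theta -> cubes X (g \o theta)) -> cubes X g.
  move=> le h; apply: (cube_comp hX (h _ (@pad_coordwise _ _ false)) (@pad_coordwise _ _ false)).
  by move=> v /=; rewrite padK.
elim: n f => [|n IH] f h; first exact: small.
case: (leqP n.+1 k.+2) => [le|gt]; first exact: small.
have [|c [cc cE]] := @nil_corner _ hX n.+1 f.
  move=> i; apply: IH => t ct; apply: h.
  exact: coordwise_comp (@lower_face_coordwise _ i) ct.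
have top1 : @pad k.+2 n.+1 true (vertex1 _) = vertex1 _.
  by apply/eqP; rewrite pad_vertex1 // ltnW.
suff <- : c = f by [].
apply: funext => v; have [->|/cE //] := eqVneq v (vertex1 _).
rewrite -top1; apply: (cube_uniq (c := c \o _) (c' := f \o _)).
- exact: cube_comp cc (@pad_coordwise _ _ true) _.
- exact/h/pad_coordwise.
- by move=> w ne /=; apply: cE; rewrite pad_vertex1 // ltnW.
Qed.

Lemma nb_tip_uniq (a : dcube k.+1 -> X) z y y' : nb a (tip z y) -> nb a (tip z y') -> y = y'.
Proof.
move=> h h'; have := cube_uniq h h'.
have del1 : del ord0 (vertex1 k.+2) = vertex1 _ by apply/ffunP => j; rewrite !ffunE.
rewrite /glue ffunE del1 /tip !upd_at; apply=> v ne.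
case: ifP => // v0; rewrite /upd; case: eqP => // E; case/eqP: ne.
by rewrite -(delK ord0 v) v0 E -del1 -{2}[vertex1 _](delK ord0) ffunE.
Qed.

Lemma cube_edge n (x y : X) : cubes X (fun v : dcube n.+1 => if v ord0 then y else x).
Proof.
apply: (cube_comp hX (c := fun v : dcube 1 => if v ord0 then y else x)
  (theta := fun v : dcube n.+1 => [ffun => v ord0])).
- exact: nil_ergodic1.
- by move=> j; cw_coord (ord0 : 'I_n.+1) false.
- by move=> v; rewrite ffunE.
Qed.

Lemma nb_tip_exists x y z : nil_sim k x y -> exists y', nb (tip x y) (@tip X k.+1 z y').
Proof.
move=> /(nil_simE hX) cxy.
have [i|c [cc cE]] := @nil_corner _ hX k.+2 (glue ord0 (@tip X k.+1 x y) (fun _ => z)).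
  rewrite lower_face_ins; case: (unliftP ord0 i) => [j|] ->; last first.
    suff -> : glue ord0 (tip x y) (fun=> z) \o ins ord0 false = @tip X k.+1 x y by [].
    by apply: funext => v /=; rewrite glue_ins.
  suff -> : glue ord0 (tip x y) (fun=> z) \o ins (lift ord0 j) false =
            (fun v : dcube k.+1 => if v ord0 then z else x) by apply: cube_edge.
  apply: funext => v /=; rewrite /glue.
  have -> : ins (lift ord0 j) false v ord0 = v ord0.
    have E : lift (lift ord0 j) ord0 = ord0 :> 'I_k.+2 by apply: val_inj.
    by rewrite -{2}E ins_lift.
  case: ifP => // _; rewrite /tip /upd; case: eqP => // /ffunP/(_ j).
  by rewrite !ffunE unlift_none.
exists (c (vertex1 _)); rewrite /nb; suff <- : c = glue ord0 (tip x y) (tip z (c (vertex1 _))) by [].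
apply: funext => v; have [->|ne] := eqVneq v (vertex1 _).
  rewrite /glue ffunE (_ : del ord0 _ = vertex1 _) /tip ?upd_at //.
  by apply/ffunP => j; rewrite !ffunE.
rewrite (cE v ne) /glue; case: ifP => // v0; rewrite /tip /upd; case: eqP => // E.
case/eqP: ne; rewrite -(delK ord0 v) v0 E; apply/ffunP => j.
by case: (unliftP ord0 j) => [j'|] ->; rewrite ?ins_lift ?ins_same !ffunE.
Qed.

(* Translations of height k: they act on the edges of (k+1)-cubes; for this it
   suffices to look at cubes that are constant off one edge on each side. *)
Definition is_transl (f : X -> X) : Prop :=
  (forall z, nil_sim k z (f z)) /\
  (forall z z', nb (@tip X k.+1 z (f z)) (tip z' (f z'))).

(** The translation taking [x] to [y] sends [z] to the point [y'] for which the pair [z, y'] is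
    parallel to [x, y]; transitivity of [nb] makes all pairs so obtained parallel to one another. *)
Lemma transl_exists x y : nil_sim k x y -> exists f, is_transl f /\ f x = y.
Proof.
move=> sxy; have [f fP] := choice (fun z => nb_tip_exists z sxy).
exists f; split; last first.
  by apply: (nb_tip_uniq (fP x)); apply: (nb_refl hX); exact: (nb_left hX (fP x)).
split=> [z|z z']; first by apply/(nil_simE hX); exact: (nb_right hX (fP z)).
exact: (nb_trans hX (nb_sym hX (fP z))).
Qed.

Lemma transl_uniq f g x : is_transl f -> is_transl g -> f x = g x -> f =1 g.
Proof.
move=> [_ tf] [_ tg] E z; apply: (@nb_tip_uniq (tip x (f x))); first exact: tf.
by rewrite E; apply: tg.
Qed.

(** All coordinates but [i] are constant on the edge, so [mix_steps] collapses them and leaves two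
    adjacent tips as in [is_transl]; a reflection of the cube moves their vertex [w] to [1]. *)
Lemma transl_edge f (c : dcube k.+2 -> X) i (w : dcube k.+1) :
  is_transl f -> cubes X c ->
  cubes X (fun v => if del i v == w then f (c v) else c v).
Proof.
move=> [_ tf] cc; pose s := [seq j <- enum 'I_k.+2 | j != i].
have [|_ h] := @mix_steps X hX _ s (ins i false w) (fun v => del i v == w) (f \o c) c cc.
  move=> j v; rewrite mem_filter => /andP[ji _] /eqP <-.
  case: (unliftP i j) ji => [j'|] ->; last by rewrite eqxx.
  by rewrite ins_lift ffunE.
apply: h; pose z b := c (ins i b w).
have -> : mix (fun v => del i v == w) (f \o c) (c \o setcs s (ins i false w)) =
    glue i (upd (fun _ => z false) w (f (z false))) (upd (fun _ => z true) w (f (z true))).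
  apply: funext => v; rewrite /mix /glue /upd /=.
  have -> : setcs s (ins i false w) v = ins i (v i) w.
    apply/ffunP => j; rewrite ffunE mem_filter mem_enum andbT.
    case: (unliftP i j) => [j'|] ->; last by rewrite eqxx /= ins_same.
    by rewrite eq_sym neq_lift !ins_lift.
  case: eqP => [E|_]; last by rewrite /z; case: (v i).
  by rewrite -{1}(delK i v) E /z; case: (v i).
apply/(nbE hX); pose u := xorc w (vertex1 _).
apply: (cube_comp hX (tf (z false) (z true)) (xorc_coordwise (ins ord0 false u))) => v.
rewrite /glue ffunE ins_same addbF.
have E : (del ord0 (xorc (ins ord0 false u) v) == vertex1 _) = (del ord0 v == w).
  have -> : del ord0 (xorc (ins ord0 false u) v) = xorc u (del ord0 v).
    by apply/ffunP => j; rewrite !ffunE liftK !ffunE.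
  rewrite -(inj_eq (can_inj (xorcK u))) xorcK; congr (_ == _).
  by apply/ffunP => j; rewrite !ffunE; case: (w j).
by rewrite /tip /upd E.
Qed.

Lemma transl_id : is_transl id.
Proof.
split=> [z|z z']; first exact: sim_refl.
have E (x : X) : @tip X k.+1 x x = fun _ => x by rewrite /tip (upd_same (fun _ => x)).
by rewrite !E; apply: cube_edge.
Qed.

Lemma transl_comp f g : is_transl f -> is_transl g -> is_transl (f \o g).
Proof.
move=> tf tg; split=> [z|z z'] /=.
  exact: (sim_trans hX (tg.1 z) (tf.1 _)).
have := transl_edge ord0 (vertex1 _) tf (tg.2 z z').
set c := fun v => _; suff -> : c = glue ord0 (tip z (f (g z))) (tip z' (f (g z'))) by [].
apply: funext => v; rewrite /c /glue /tip /upd.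
by case: (v ord0); case: eqP.
Qed.

(* Acting on two adjacent edges of a constant cube, in either order, gives two cubes
   that agree off the common vertex. *)
Lemma translC f g : is_transl f -> is_transl g -> f \o g =1 g \o f.
Proof.
move=> tf tg z; pose i1 : 'I_k.+2 := lift ord0 ord0.
pose one := vertex1 k.+1.
have cz : cubes X (fun _ : dcube k.+2 => z) by apply: cube_const.
have cfg := transl_edge i1 one tf (transl_edge ord0 one tg cz).
have cgf := transl_edge ord0 one tg (transl_edge i1 one tf cz).
have del1 i : del i (vertex1 k.+2) = one by apply/ffunP => j; rewrite !ffunE.
have := cube_uniq cfg cgf; rewrite /= !del1 eqxx; apply=> v ne.
case: (eqVneq (del ord0 v) one) => [E0|//].
case: (eqVneq (del i1 v) one) => [E1|//]; case/eqP: ne; apply/ffunP => j.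
rewrite ffunE; case: (unliftP ord0 j) => [j'|] ->.
  by move/ffunP/(_ j'): E0; rewrite !ffunE.
have E : lift i1 ord0 = ord0 :> 'I_k.+2 by apply: val_inj.
by move/ffunP/(_ ord0): E1; rewrite !ffunE E.
Qed.

Lemma transl_inv f : is_transl f -> exists g, [/\ is_transl g, cancel f g & cancel g f].
Proof.
move=> tf; have [x0] := nil_nonempty hX.
have [g [tg gx]] := transl_exists (sim_sym (tf.1 x0)).
exists g; split=> // z.
  exact: (transl_uniq (x := x0) (transl_comp tg tf) transl_id gx).
by apply: (transl_uniq (x := f x0) (transl_comp tf tg) transl_id); rewrite /= gx.
Qed.

(** * Cubes of a translation action *)

Section Action.
Variables (A : zmodType) (act : X -> A -> X).
Hypotheses (act0 : forall x, act x 0 = x)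
  (actD : forall x a b, act x (a + b) = act (act x a) b)
  (act_transl : forall a, is_transl (act ^~ a))
  (act_free : forall x a b, act x a = act x b -> a = b).

(** Since [e] does not vary in direction [i], the change is a composite of translations along single
    edges, one for each [w]. *)
Lemma act_degenerate i (c : dcube k.+2 -> X) (e : dcube k.+2 -> A) :
  cubes X c -> (forall v b, e (setc i b v) = e v) -> cubes X (fun v => act (c v) (e v)).
Proof.
move=> cc eE.
suff H (s : seq (dcube k.+1)) : cubes X (fun v => if del i v \in s then act (c v) (e v) else c v).
  suff <- : (fun v => if del i v \in enum (dcube k.+1) then act (c v) (e v) else c v) =
    fun v => act (c v) (e v) by [].
  by apply: funext => v; rewrite mem_enum.
elim: s => [//|w s IH]; have [ws|ws] := boolP (w \in s).
  suff -> : (fun v => if del i v \in w :: s then act (c v) (e v) else c v) =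
     (fun v => if del i v \in s then act (c v) (e v) else c v) by [].
  by apply: funext => v; rewrite inE; case: eqP => [->|//]; rewrite ws.
have := transl_edge i w (act_transl (e (ins i false w))) IH.
congr cubes; apply: funext => v; rewrite inE; case: eqP => [E|//] /=.
rewrite -[X in _ = act _ (e X)](delK i v) E (negbTE ws).
by rewrite -(eE (ins i (v i) w) false) setc_ins.
Qed.

(** Subtracting from [d] a function that does not vary in some direction changes neither side. Doing
    this in every direction pushes the support to the vertex [1]; there the claim says that a change
    at one vertex of a (k+2)-cube must be trivial. [t] lists the directions still to be treated. *)
Lemma act_cube_csum (c : dcube k.+2 -> X) (d : dcube k.+2 -> A) : cubes X c ->
  cubes X (fun v => act (c v) (d v)) <-> csum d = 0.
Proof.
suff H (t : seq 'I_k.+2) (d' : dcube k.+2 -> A) : (forall (v : dcube k.+2) j, j \notin t -> v j = false -> d' v = 0) ->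
    cubes X c -> (cubes X (fun v => act (c v) (d' v)) <-> csum d' = 0).
  by move=> cc; apply: (H (enum 'I_k.+2) d _ cc) => v j; rewrite mem_enum.
elim: t d' => [|i t IH] d' dE cc.
  have dE1 v : v != vertex1 _ -> d' v = 0.
    move=> ne; have /existsP[j /negbTE vj] : [exists j, ~~ v j].
      move: ne; apply: contraR; rewrite negb_exists => /forallP all.
      by apply/eqP/ffunP => j; rewrite ffunE; move: (all j); rewrite negbK.
    exact: dE vj.
  have -> : (fun v => act (c v) (d' v)) = upd c (vertex1 _) (act (c (vertex1 _)) (d' (vertex1 _))).
    apply: funext => v; rewrite /upd; case: eqP => [->//|/eqP ne].
    by rewrite dE1 ?act0.
  have cs : csum d' = d' (vertex1 _) *~ (-1) ^+ weight (vertex1 k.+2).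
    by rewrite /csum (bigD1 (vertex1 _)) //= big1 ?addr0 // => v /dE1 ->; rewrite mul0rz.
  rewrite (cube_updE hX) //; split=> [/hS E|E].
    rewrite cs (_ : d' (vertex1 _) = 0) ?mul0rz //.
    by apply: (act_free (x := c (vertex1 _))); rewrite act0.
  suff -> : d' (vertex1 _) = 0 by rewrite act0; apply: sim_refl.
  by move: E; rewrite cs => /sign_eq0.
pose e v := d' (setc i false v).
have eE v b : e (setc i b v) = e v.
  by rewrite /e; congr (d' _); apply/ffunP => j; rewrite !ffunE; case: eqP.
have -> : csum d' = csum (fun v => d' v - e v).
  have eg : e = glue i (fun w => d' (ins i false w)) (fun w => d' (ins i false w)).
    by apply: funext => v; rewrite /e -{1}(delK i v) setc_ins /glue; case: ifP.
  by rewrite csumB eg csum_glue subrr subr0.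
rewrite -(IH (fun v => d' v - e v)) //; last first.
  move=> v j jt vj; rewrite /e; case: (eqVneq j i) => [E|ji].
    have -> : setc i false v = v.
      by apply/ffunP => l; rewrite ffunE; case: eqP => [->|//]; rewrite -E vj.
    by rewrite subrr.
  have jit : j \notin i :: t by rewrite inE negb_or ji.
  by rewrite !(dE _ j) ?subrr // ffunE (negbTE ji).
split=> h.
  have := act_degenerate (e := fun v => - e v) h (i := i).
  have -> : (fun v => act (act (c v) (d' v)) (- e v)) = fun v => act (c v) (d' v - e v).
    by apply: funext => v; rewrite actD.
  by apply=> v b; rewrite eE.
have := act_degenerate h eE.
suff -> : (fun v => act (act (c v) (d' v - e v)) (e v)) = fun v => act (c v) (d' v) by [].
by apply: funext => v; rewrite -actD subrK.
Qed.

Lemma act_cubes n (c : dcube n -> X) (d : dcube n -> A) : cubes X c ->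
  cubes X (fun v => act (c v) (d v)) <-> cubes (Dspace k.+1 A) d.
Proof.
move=> cc; split=> [cc' theta mt|cd].
  apply/(act_cube_csum (c := c \o theta)); first exact: (nil_comp hX).
  exact: (nil_comp hX cc' mt).
apply: cube_by_faces => theta ct.
have cct : cubes X (c \o theta) by apply: (cube_comp hX cc ct).
by apply/(act_cube_csum (d \o theta) cct)/cd/coordwise_morphism.
Qed.

Lemma transl_top_action : (forall x y, nil_sim k x y -> exists a, act x a = y) ->
  top_action k act.
Proof. by split=> //; [move=> x a; apply: (act_transl a).1 | apply: act_cubes]. Qed.

End Action.
End Translations.

Lemma top_action_exists (T : finType) (C : forall n, (dcube n -> T) -> Prop) k :
  is_step_nilspace k.+1 (Cubespace C) ->
  exists (A : finZmodType) (act : T -> A -> T), @top_action (Cubespace C) k A act.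
Proof.
set X := Cubespace C => -[hX sX]; have hS x y : @nil_sim X k.+1 x y -> x = y.
  by move/(sim_step hX sX).
pose A := {f : {ffun T -> T} | `[< @is_transl X k f >]}.
have trP (a : A) : @is_transl X k (val a) by apply/asboolP/(valP a).
have mk (f : T -> T) : @is_transl X k f -> {a : A | val a =1 f}.
  move=> tf; have tf' : `[< @is_transl X k (finfun f) >].
    apply/asboolP; suff -> : (finfun f : T -> T) = f by [].
    by apply: funext => x; rewrite ffunE.
  by exists (exist _ (finfun f) tf') => x /=; rewrite ffunE.
pose add (a b : A) : A := sval (mk _ (transl_comp hX (trP a) (trP b))).
have addE a b x : val (add a b) x = val a (val b x) by rewrite (svalP (mk _ _)).
pose zero : A := sval (mk _ (transl_id k hX)).
have zeroE x : val zero x = x by rewrite (svalP (mk _ _)).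
have [opp oppE] : {opp : A -> A & forall a x, val (opp a) (val a x) = x}.
  apply: (@choice _ _ (fun a b : A => forall x, val b (val a x) = x)) => a.
  have [g [tg gK _]] := transl_inv hX hS (trP a).
  by exists (sval (mk g tg)) => x; rewrite (svalP (mk _ _)).
have ext (a b : A) : val a =1 val b -> a = b by move=> E; apply/val_inj/ffunP.
have addA : associative add by move=> a b c; apply: ext => x; rewrite !addE.
have addC : commutative add.
  by move=> a b; apply: ext => x; rewrite !addE; apply: (translC hX hS (trP a) (trP b)).
have add0 : left_id zero add by move=> a; apply: ext => x; rewrite addE zeroE.
have addN : left_inverse zero opp add by move=> a; apply: ext => x; rewrite addE zeroE oppE.
pose G := HB.pack_for finZmodType A (GRing.isZmodule.Build A addA addC add0 addN).
exists G, (fun x (a : G) => val (a : A) x).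
apply: transl_top_action => //.
(* The sum [a + b] is the composite applying [b] first, while [act] is a right action: commutativity
   reconciles them. *)
- by move=> x a b; apply: etrans (congr1 (fun f : A => val f x) (addC a b)) (addE b a x).
- by move=> x a b E; apply: ext; apply: (transl_uniq hX hS (trP a) (trP b) E).
- move=> x y /(transl_exists hX hS) [f [tf fx]].
  by exists (sval (mk f tf)); rewrite (svalP (mk _ _)).
Qed.

(** * Counting completions *)

Lemma glue_inj_right X n (i : 'I_n.+1) (a b b' : dcube n -> X) :
  glue i a b = glue i a b' -> b = b'.
Proof.
move=> E; apply: funext => v; move: (congr1 (fun f => f (ins i true v)) E).
by rewrite !glue_ins.
Qed.

Section Counting.
Variables (T : finType) (C : forall n, (dcube n -> T) -> Prop).
Let X := Cubespace C.
Variable k : nat.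
Hypotheses (hX : is_nilspace X) (hS : forall x y : X, nil_sim k x y -> x = y).
Implicit Types x y z : T.

Definition class_size i x : nat := #|[pred y : T | `[< @nil_sim X i x y >]]|.

Lemma class_size_gt0 i x : (0 < class_size i x)%N.
Proof. by apply/card_gt0P; exists x; rewrite inE; apply/asboolP/sim_refl. Qed.

(** One completion [y0] exists, and by [cube_updE] the others are the points [~_(i+1)]-equivalent to
    it. *)
Lemma card_tip i x y z : @nil_sim X i x y ->
  exists y0, #|[pred y' | `[< nb (@tip X i.+1 x y) (tip z y') >]]| = class_size i.+1 y0.
Proof.
move=> /(nb_tip_exists hX z) [y0 h0]; exists y0; apply: eq_card => y' /=.
rewrite !inE; apply: asbool_equiv_eq.
have c1 : glue ord0 (@tip X i.+1 x y) (tip z y0) (vertex1 _) = y0.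
  rewrite /glue ffunE (_ : del ord0 _ = vertex1 _) /tip ?upd_at //.
  by apply/ffunP => j; rewrite !ffunE.
have := @cube_updE X hX i.+1 _ (vertex1 _) y' h0; rewrite c1.
suff -> : upd (glue ord0 (@tip X i.+1 x y) (tip z y0)) (vertex1 i.+2) y' =
  glue ord0 (@tip X i.+1 x y) (tip z y') by exact.
apply: funext => v; rewrite /glue /tip /upd; case: eqP => [->|ne].
  rewrite ffunE (_ : del ord0 _ = vertex1 _) ?eqxx //.
  by apply/ffunP => j; rewrite !ffunE.
case: ifP => // v0; case: eqP => // E; case: ne.
rewrite -(delK ord0 v) v0 E; apply/ffunP => j.
by case: (unliftP ord0 j) => [j'|] ->; rewrite ?ins_lift ?ins_same !ffunE.
Qed.

(* Double count the pairs (y, y') with y ~_i x, y' ~_i x' and (x, y) parallel to (x', y'). *)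
Lemma class_size_uniform_step i :
  (forall x x', class_size i.+1 x = class_size i.+1 x') ->
  forall x x', class_size i x = class_size i x'.
Proof.
move=> U x x'.
pose P y y' := `[< nb (@tip X i.+1 x y) (@tip X i.+1 x' y') >].
have count1 z z' : (\sum_(y | `[< @nil_sim X i z y >])
    \sum_(y' | `[< nb (@tip X i.+1 z y) (@tip X i.+1 z' y') >]) 1 = class_size i z * class_size i.+1 x)%N.
  rewrite /class_size -sum_nat_const; apply: eq_big => [//|y /asboolP syz].
  by have [y0 E] := card_tip z' syz; rewrite sum1_card E (U y0 x).
have H z z' : (class_size i z * class_size i.+1 x <= class_size i z' * class_size i.+1 x)%N.
  rewrite -(count1 z z') -(count1 z' z).
  rewrite (exchange_big_dep (fun y' => `[< @nil_sim X i z' y' >])) /=; last first.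
    move=> y y' _ /asboolP h; apply/asboolP/(nil_simE hX).
    exact: (nb_right hX h).
  apply: leq_sum => y' _; rewrite !sum1_card; apply: subset_leq_card.
  apply/fintype.subsetP => y; rewrite !unfold_in => /andP[_ /asboolP h].
  by apply/asboolP/(@nb_sym X hX).
apply/eqP; rewrite -(eqn_pmul2r (class_size_gt0 i.+1 x)) eqn_leq.
by rewrite !H.
Qed.

(** Descending induction on [i], starting from [~_k], whose classes are points. *)
Lemma class_size_uniform i x x' : class_size i x = class_size i x'.
Proof.
have [m le] := ubnP (k - i); elim: m i le x x' => // m IH i le x x'.
have [ki|ik] := leqP k i.
  have one y : class_size i y = 1%N.
    rewrite /class_size -(card1 y); apply: eq_card => z; rewrite !inE.
    apply/asboolP/eqP => [h|->]; last exact: sim_refl.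
    by rewrite (hS (sim_le hX ki h)).
  by rewrite !one.
apply: class_size_uniform_step; apply: IH.
by rewrite -ltnS (leq_trans _ le) // ltnS subnS prednK // subn_gt0.
Qed.

Lemma class_size_dvd i x : (class_size i x %| #|T|)%N.
Proof.
pose R y z := `[< @nil_sim X i y z >].
have eqR : {in [set: T] & &, equivalence_rel R}.
  move=> y z w _ _ _; split; first by apply/asboolP/sim_refl.
  move=> /asboolP yz; apply/asboolP/asboolP => h.
    exact: (sim_trans hX (sim_sym yz)).
  exact: (sim_trans hX yz).
have := equivalence_partitionP eqR => /(@card_uniform_partition _ (class_size i x)).
rewrite cardsT => -> ; first exact: dvdn_mull.
move=> A /imsetP[y _ ->]; rewrite (class_size_uniform i x y); apply: eq_card => z.
by rewrite !inE.
Qed.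

Variable x0 : T.

(** The number of completions of an [l]-dimensional corner: every point for [l = 0], otherwise one
    class of [~_(l-1)]. The base point [x0] is arbitrary, as all classes of one relation have the
    same size. *)
Definition completions l : nat := if l is i.+1 then class_size i x0 else #|T|.

Lemma completions_dvd l : (completions l %| #|T|)%N.
Proof. by case: l => [|l]; [apply: dvdnn|apply: class_size_dvd]. Qed.

Lemma card_corner n (u : dcube n) (f : dcube n -> T) :
  (forall v, lec v u -> v != u -> C (f \o meetc v)) ->
  #|[pred y | `[< C (upd f u y \o meetc u) >]]| = completions (weight u).
Proof.
move=> h; have [y0 c0] := @corner_at X hX n u f h.
have [e [r [[ce cr K] [K' e1 em]]]] := face_maps u.
have eu t : (e t == u) = (t == vertex1 _) by rewrite -(inj_eq (can_inj K)) e1.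
have E : [pred y | `[< C (upd f u y \o meetc u) >]] =i
    [pred y | `[< C (upd (upd f u y0 \o e) (vertex1 _) y) >]].
  move=> y; rewrite !inE; apply: asbool_equiv_eq.
  apply: iff_trans (@cube_at_face X hX _ _ e r _ ce cr K K') _.
  suff -> : upd f u y \o e = upd (upd f u y0 \o e) (vertex1 _) y by [].
  by apply: funext => t; rewrite /upd /= eu; case: eqP.
rewrite (eq_card E) => {E}.
have /(@cube_at_face X hX _ _ e r _ ce cr K K') : cubes X (upd f u y0 \o meetc u) by [].
move: (upd f u y0 \o e) => g.
case: (weight u) g => [|l] g cg /=.
  by apply: eq_card => y; rewrite !inE; apply/asboolP/(@cube_dim0 X hX).
rewrite (class_size_uniform l x0 (g (vertex1 _))); apply: eq_card => y; rewrite !inE.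
apply: asbool_equiv_eq; exact: (@cube_updE X hX l g).
Qed.

(** This counts the greedy fillings of [extend_downset]: each added vertex contributes a factor that
    depends on its weight alone, so the total does not depend on [f]. *)
Lemma card_extensions n (D : pred (dcube n)) (f : dcube n -> T) :
  downset D -> @partial_cube X n D f ->
  #|[pred c : {ffun dcube n -> T} | `[< C c >] && [forall v, D v ==> (c v == f v)]]| =
  (\prod_(u | ~~ D u) completions (weight u))%N.
Proof.
have [m] := ubnP #|[pred v | ~~ D v]|; elim: m D f => // m IH D f lt dD pf.
have [/forallP all|nall] := boolP [forall v, D v].
  rewrite big_pred0 => [|v]; last by rewrite all.
  rewrite -(card1 (finfun f)); apply: eq_card => c; rewrite !inE.
  have cf : C f.
    suff -> : f = f \o meetc (vertex1 _) by exact: pf.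
    by apply: funext => v /=; rewrite meetc1.
  apply/andP/eqP => [[_ /forallP h]|->].
    by apply/ffunP => v; rewrite ffunE; apply/eqP; move: (h v); rewrite all.
  split; last by apply/forallP => v; rewrite ffunE eqxx implybT.
  by apply/asboolP; rewrite (_ : (finfun f : dcube n -> T) = f) //; apply: funext => v; rewrite ffunE.
have [u [Du umin]] := downset_min nall.
rewrite (bigD1 u) //= -(@card_corner n u f); last by move=> v le ne; apply/pf/umin.
pose D' v := (v == u) || D v.
have -> : (\prod_(i | ~~ D i && (i != u)) completions (weight i) =
           \prod_(i | ~~ D' i) completions (weight i))%N.
  by apply: eq_bigl => v; rewrite /D' negb_or andbC.
rewrite -sum1_card (partition_big (fun c : {ffun dcube n -> T} => c u)
  (fun y => `[< C (upd f u y \o meetc u) >])) /=; last first.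
  move=> c /andP[/asboolP cc /forallP cE]; apply/asboolP.
  suff -> : upd f u (c u) \o meetc u = c \o meetc u.
    exact: (@cube_comp X hX _ _ _ _ _ cc (meetc_coordwise u)).
  apply: funext => v /=; rewrite /upd; case: eqP => [->//|/eqP ne].
  by apply/esym/eqP; move: (cE (meetc u v)); rewrite umin ?meetc_le.
rewrite -sum_nat_const; apply: eq_big => [//|y /asboolP cy].
rewrite -(IH D' (upd f u y)); last 3 first.
- by move: lt; rewrite (card_downsetU Du).
- exact: downsetU.
- exact: (@partial_cube_upd X).
rewrite sum1_card; apply: eq_card => c; rewrite !unfold_in /= -andbA; congr (_ && _).
apply/andP/forallP => [[/forallP cE /eqP cu] v|h].
  rewrite /D' /upd; apply/implyP => /=; case: eqP => [->|_ /= Dv]; first by rewrite cu.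
  by move: (cE v); rewrite Dv.
split; last by move: (h u); rewrite /D' /upd eqxx.
apply/forallP => v; apply/implyP => Dv; move: (h v); rewrite /D' /upd Dv orbT /=.
by case: (eqVneq v u) => [E|//]; move: Du; rewrite -E Dv.
Qed.

(** The vertices with [u ord0] are those left to be filled when one face of an (n+1)-cube is
    prescribed. *)
Definition nb_count n : nat := (\prod_(u : dcube n.+1 | u ord0) completions (weight u))%N.

Definition sq_count n : nat :=
  (\prod_(u : dcube n.+2 | u ord0 && u (lift ord0 ord0)) completions (weight u))%N.

(* The (n+2)-cubes with faces a, b and a', b' in two new directions; the definition
   treats both directions alike, see [sq_tr]. *)
Definition sq n (a b a' b' : dcube n -> T) : Prop :=
  @nb X n.+1 (glue ord0 a a') (glue ord0 b b').

Lemma card_nb n (c : dcube n -> T) : C c ->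
  #|[pred e : {ffun dcube n -> T} | `[< @nb X n c e >]]| = nb_count n.
Proof.
move=> cc; have nn : @nb X n c c by apply: nb_refl.
pose F (e : {ffun dcube n -> T}) : {ffun dcube n.+1 -> T} := [ffun v => glue ord0 c e v].
have FE e : (F e : dcube n.+1 -> T) = glue ord0 c e by apply: funext => v; rewrite ffunE.
have F_inj : injective F.
  move=> e e' E; apply/ffunP => v; have := congr1 (fun f : {ffun _} => f : _ -> _) E.
  by rewrite !FE => /glue_inj_right ->.
have := @card_extensions n.+1 (fun v => ~~ v ord0) (glue ord0 c c); rewrite /nb_count.
have -> : (\prod_(u : dcube n.+1 | ~~ ~~ u ord0) completions (weight u))%N =
          (\prod_(u : dcube n.+1 | u ord0) completions (weight u))%N.
  by apply: eq_bigl => u; rewrite negbK.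
move=> <-; last 2 first.
- by move=> u v /lecP le; apply: contra => /le.
- by move=> u _; apply: (cube_comp hX nn (meetc_coordwise u)).
rewrite -(card_image F_inj); apply: eq_card => g; rewrite !inE.
apply/imageP/andP => [[e /asboolP he ->]|[/asboolP cg /forallP gE]].
  split; first by apply/asboolP; rewrite FE.
  apply/forallP => v; apply/implyP => /negbTE v0.
  by rewrite FE /glue v0.
have E : g = F [ffun w => g (ins ord0 true w)].
  apply/ffunP => v; rewrite ffunE /glue; case: ifP => v0.
    by rewrite ffunE -v0 delK.
  by move: (gE v); rewrite /glue v0 /= => /eqP.
exists [ffun w => g (ins ord0 true w)] => //.
by rewrite inE; apply/asboolP; rewrite /nb -FE -E.
Qed.

Lemma card_sq n (a b a' : dcube n -> T) : @nb X n a b -> @nb X n a a' ->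
  #|[pred b' : {ffun dcube n -> T} | `[< sq a b a' b' >]]| = sq_count n.
Proof.
move=> hab haa'; pose i1 : 'I_n.+2 := lift ord0 ord0.
pose F (e : {ffun dcube n -> T}) : {ffun dcube n.+2 -> T} :=
  [ffun v => glue ord0 (glue ord0 a a') (glue ord0 b e) v].
have FE e : (F e : dcube n.+2 -> T) = glue ord0 (glue ord0 a a') (glue ord0 b e).
  by apply: funext => v; rewrite ffunE.
have F_inj : injective F.
  move=> e e' E; apply/ffunP => v; have := congr1 (fun f : {ffun _} => f : _ -> _) E.
  by rewrite !FE => /glue_inj_right /glue_inj_right ->.
have := @card_extensions n.+2 (fun v => ~~ (v ord0 && v i1))
  (glue ord0 (glue ord0 a a') (glue ord0 b b)).
have -> : (\prod_(u : dcube n.+2 | ~~ ~~ (u ord0 && u i1)) completions (weight u))%N = sq_count n.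
  by apply: eq_bigl => u; rewrite negbK.
move=> <-; last 2 first.
- by move=> u v /lecP le; apply: contra => /andP[/le -> /le].
- move=> u; rewrite negb_and => /orP[/negbTE u0|/negbTE u1].
    apply: (cube_comp hX haa' (coordwise_comp (del_coordwise ord0) (meetc_coordwise u))) => v /=.
    by rewrite {1}/glue ffunE u0 andbF.
  apply: (cube_comp hX hab (coordwise_comp (del_coordwise i1) (meetc_coordwise u))) => v /=.
  have E0 : lift i1 ord0 = ord0 :> 'I_n.+2 by apply: val_inj.
  have E w : del ord0 (del i1 w) = del ord0 (del ord0 w) :> dcube n.
    by apply/ffunP => j; rewrite !ffunE; congr (w _); apply: val_inj.
  rewrite /glue -!E [del i1 _ ord0]ffunE E0.
  by rewrite [del ord0 _ ord0]ffunE [meetc u v (lift ord0 ord0)]ffunE u1 andbF.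
rewrite -(card_image F_inj); apply: eq_card => g; rewrite !inE.
apply/imageP/andP => [[e /asboolP he ->]|[/asboolP cg /forallP gE]].
  split; first by apply/asboolP; rewrite FE.
  apply/forallP => v; apply/implyP => nv.
  rewrite FE /glue; move: nv; case: (v ord0) => //=; rewrite ffunE.
  by rewrite -/i1 => /negbTE ->.
have E : g = F [ffun w => g (ins ord0 true (ins ord0 true w))].
  apply/ffunP => v; rewrite FE.
  have [/andP[v0 v1]|nv] := boolP (v ord0 && v i1).
    rewrite /glue v0 [del ord0 v ord0]ffunE v1 ffunE.
    have e1 : del ord0 v ord0 = true by rewrite ffunE.
    by rewrite -{2}e1 delK -v0 delK.
  move: (gE v); rewrite nv /= => /eqP ->; rewrite /glue.
  move: nv; case: (v ord0) => //=; rewrite [del ord0 v ord0]ffunE.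
  by rewrite -/i1 => /negbTE ->.
exists [ffun w => g (ins ord0 true (ins ord0 true w))] => //.
by rewrite inE; apply/asboolP; rewrite /sq /nb -FE -E.
Qed.

Lemma coprime_nb_count n m : coprime #|T| m -> coprime (nb_count n) m.
Proof.
move=> h; rewrite /nb_count; elim/big_ind: _ => [|p q|u _]; first exact: coprime1n.
  by rewrite coprimeMl => -> ->.
exact: coprime_dvdl (completions_dvd _) h.
Qed.

Lemma coprime_sq_count n m : coprime #|T| m -> coprime (sq_count n) m.
Proof.
move=> h; rewrite /sq_count; elim/big_ind: _ => [|p q|u _]; first exact: coprime1n.
  by rewrite coprimeMl => -> ->.
exact: coprime_dvdl (completions_dvd _) h.
Qed.

End Counting.

(** * Averaging cocycles *)

(** [r] is an inverse of [p] modulo [m], so that averages over [p] terms can be formed in the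
    [m]-torsion of any group. For [p = 0] coprimality forces [m = 1]. *)
Lemma coprime_inverse p m : coprime p m ->
  exists r, forall (A : zmodType) (a : A), a *+ m = 0 -> a *+ (p * r) = a.
Proof.
case: p => [|p]; first by rewrite /coprime gcd0n => /eqP ->; exists 0%N => A a; rewrite mulr1n.
move=> co; have [u v E _] := @egcdnP p.+1 m isT.
by exists u => A a am; rewrite mulnC E (eqP co) mulrnDr mulnC mulrnA am mul0rn add0r mulr1n.
Qed.

Lemma coprime_torsion (A : zmodType) (a : A) p q :
  coprime p q -> a *+ p = 0 -> a *+ q = 0 -> a = 0.
Proof.
by move=> /coprime_inverse [r rP] ap /rP; rewrite mulrnA ap mul0rn.
Qed.

Lemma glue_comm X n (i : 'I_n.+1) (a b a' b' : dcube n -> X) :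
  glue ord0 (glue i a b) (glue i a' b') = glue (lift ord0 i) (glue ord0 a a') (glue ord0 b b').
Proof.
apply: funext => v; rewrite /glue.
have -> : del ord0 v i = v (lift ord0 i) by rewrite ffunE.
have -> : del (lift ord0 i) v ord0 = v ord0.
  by rewrite ffunE; congr (v _); apply: val_inj.
suff -> : del ord0 (del (lift ord0 i) v) = del i (del ord0 v) by case: (v ord0); case: (v _).
apply/ffunP => j; rewrite !ffunE; congr (v _); apply: val_inj.
by rewrite /= /bump !leq0n leq_add2l addnCA.
Qed.

Definition additive_dir (X : cubespace) (A : zmodType) n (i : 'I_n.+1)
    (F : (dcube n.+1 -> X) -> A) : Prop :=
  forall a b c, nb a b -> nb b c -> F (glue i a c) = F (glue i a b) + F (glue i b c).

Definition cocycle (X : cubespace) (A : zmodType) n : ((dcube n -> X) -> A) -> Prop :=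
  if n is n'.+1 then fun F => forall i, additive_dir i F else fun _ => True.

Section Averaging.
Variables (T : finType) (C : forall n, (dcube n -> T) -> Prop).
Let X := Cubespace C.
Variable k : nat.
Hypotheses (hX : is_nilspace X) (hS : forall x y : X, nil_sim k x y -> x = y).
Variable (A : zmodType) (m : nat).
Hypothesis com : coprime #|T| m.

Notation nbX := (@nb X _).
Notation sqX := (@sq T C _).

Variable x0 : T.
Let K n := nb_count C x0 n.
Let R n := sq_count C x0 n.

Lemma sq_nb n (i : 'I_n.+1) (a b a' b' : dcube n -> T) :
  nbX (glue i a b) (glue i a' b') <-> sqX a b a' b'.
Proof. by rewrite /nb glue_comm; apply: (@nbE X hX). Qed.

Lemma sq_tr n (a b a' b' : dcube n -> T) : sqX a b a' b' -> sqX a a' b b'.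
Proof. by move/(sq_nb ord0). Qed.

Lemma sq_swap n (a b a' b' : dcube n -> T) : sqX a b a' b' -> sqX b a b' a'.
Proof. exact: (nb_sym hX). Qed.

Lemma sq_left n (a b a' b' : dcube n -> T) : sqX a b a' b' -> nbX a a'.
Proof. by move=> h; apply: (nb_left hX h). Qed.

Lemma sq_right n (a b a' b' : dcube n -> T) : sqX a b a' b' -> nbX b b'.
Proof. by move=> h; apply: (nb_right hX h). Qed.

Lemma sum_glue n (i : 'I_n.+1) (P : (dcube n.+1 -> T) -> bool) (G : (dcube n.+1 -> T) -> A) :
  \sum_(e : {ffun dcube n.+1 -> T} | P e) G e =
  \sum_(a : {ffun dcube n -> T}) \sum_(b : {ffun dcube n -> T} | P (glue i a b)) G (glue i a b).
Proof.
rewrite pair_big_dep /=.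
have fE (e : dcube n.+1 -> T) : (finfun e : dcube n.+1 -> T) = e.
  by apply: funext => v; rewrite ffunE.
rewrite (reindex (fun p : {ffun dcube n -> T} * {ffun dcube n -> T} => finfun (glue i p.1 p.2))) /=.
  by apply: eq_big => [p|p _]; rewrite fE.
exists (fun e : {ffun dcube n.+1 -> T} =>
  ([ffun v => e (ins i false v)], [ffun v => e (ins i true v)])).
- by move=> [a b] _; congr (_, _); apply/ffunP => v; rewrite !ffunE glue_ins.
- move=> e _; apply/ffunP => v; rewrite ffunE /glue.
  by case E: (v i); rewrite ffunE -E delK.
Qed.

(** Sum [F (glue i a' b')] over the squares whose first side is [a, b]. Invariance gives a multiple
    of [F c] by a number prime to [m]. Additivity writes each term as
    [F (glue i a b') - F (glue i a a')], and both parts sum to the same total over the neighbours of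
    [a]. *)
Lemma additive_invariant_eq0 n (i : 'I_n.+1) (F : (dcube n.+1 -> T) -> A) c :
  @additive_dir X A n i F -> (forall c c', nbX c c' -> F c = F c') ->
  C c -> F c *+ m = 0 -> F c = 0.
Proof.
move=> Fadd Finv cc Fm.
pose a := c \o ins i false; pose b := c \o ins i true.
have cE : c = glue i a b by rewrite glue_faces.
have nab : nbX a b by apply/(@nbE X hX n i); rewrite -cE.
have na : @cubes X n a by apply: (nb_left hX nab).
pose S := \sum_(a' : {ffun dcube n -> T} | `[< nbX a a' >])
  \sum_(b' : {ffun dcube n -> T} | `[< sqX a b a' b' >]) F (glue i a' b').
have card1 a' : nbX a a' ->
    #|[pred b' : {ffun dcube n -> T} | `[< sqX a b a' b' >]]| = R n.
  by move=> h; apply: (card_sq hX hS).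
have S1 : S = F c *+ (R n * K n).
  rewrite /S (eq_bigr (fun _ => F c *+ R n)); last first.
    move=> a' /asboolP na'; rewrite -(card1 a' na') -sumr_const; apply: eq_big => // b' /asboolP h.
    by rewrite [in RHS]cE; apply/esym/Finv/sq_nb.
  by rewrite sumr_const mulrnA (card_nb hX hS x0 na).
have S0 : S = 0.
  rewrite /S (eq_bigr (fun a' : {ffun dcube n -> T} =>
    \sum_(b' : {ffun dcube n -> T} | `[< sqX a b a' b' >]) F (glue i a b') - F (glue i a a') *+ R n)).
    rewrite sumrB (exchange_big_dep (fun b' : {ffun dcube n -> T} => `[< nbX a b' >])) /=; last first.
      move=> a' b' /asboolP h1 /asboolP h2; apply/asboolP.
      exact: (nb_trans hX nab (sq_right h2)).
    apply/eqP; rewrite subr_eq0; apply/eqP; apply: eq_bigr => b' /asboolP nb'.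
    have nbb' : nbX b b' by apply: (nb_trans hX (nb_sym hX nab)).
    rewrite sumr_const; congr (_ *+ _).
    rewrite /R -(card_sq hX hS x0 (nb_sym hX nab) nbb'); apply: eq_card => a'.
    rewrite !unfold_in; apply/andP/asboolP => [[_ /asboolP]|h]; first exact: sq_swap.
    by split; apply/asboolP; [apply: sq_right h|apply: sq_swap].
  move=> a' /asboolP na'; rewrite -(card1 a' na') -sumr_const -sumrB.
  apply: eq_big => // b' /asboolP h.
  rewrite (@Fadd a a' b') //; first by rewrite addrC addKr.
  exact: (sq_right (sq_tr h)).
apply: (@coprime_torsion _ _ (R n * K n) m) => //; last by rewrite -S1.
by rewrite coprimeMl (coprime_nb_count hX hS) // (coprime_sq_count hX hS).
Qed.

(** The three sums range over different sets of squares, so they cannot be compared termwise.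
    Multiplied by [R n], the number of ways to extend a square on one side, each becomes a sum over
    the dominoes [D], where additivity applies to every term; then [R n] is cancelled, being prime
    to [m]. *)
Lemma average_additive n (i : 'I_n.+1) (F : (dcube n.+2 -> T) -> A) (a b c : dcube n -> T) :
  (forall e, F e *+ m = 0) -> @additive_dir X A n.+1 (lift ord0 i) F ->
  nbX a b -> nbX b c ->
  let S g := \sum_(e : {ffun dcube n.+1 -> T} | `[< nbX g e >]) F (glue ord0 g e) in
  S (glue i a c) = S (glue i a b) + S (glue i b c).
Proof.
move=> Fm Fadd nab nbc S.
have nac : nbX a c by apply: (nb_trans hX nab nbc).
pose H (x y x' y' : dcube n -> T) := F (glue ord0 (glue i x y) (glue i x' y')).
pose ff := {ffun dcube n -> T}.
have SE (x y : dcube n -> T) : S (glue i x y) =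
    \sum_(x' : ff) \sum_(y' : ff | `[< sqX x y x' y' >]) H x y x' y'.
  rewrite /S (sum_glue i (fun e => `[< nbX (glue i x y) e >]) (fun e => F (glue ord0 (glue i x y) e))).
  apply: eq_bigr => x' _; apply: eq_bigl => y'; apply: asbool_equiv_eq; exact: sq_nb.
pose D (a' b' c' : ff) := `[< sqX a b a' b' >] && `[< sqX b c b' c' >].
have ab : S (glue i a b) *+ R n =
    \sum_(a' : ff) \sum_(b' : ff) \sum_(c' : ff | D a' b' c') H a b a' b'.
  rewrite SE -sumrMnl; apply: eq_bigr => a' _; rewrite big_mkcond -sumrMnl.
  apply: eq_bigr => b' _; rewrite /D; case: asboolP => h; last by rewrite big_pred0_eq mul0rn.
  by rewrite sumr_const /= (card_sq hX hS x0 nbc (sq_right h)).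
have bc : S (glue i b c) *+ R n =
    \sum_(a' : ff) \sum_(b' : ff) \sum_(c' : ff | D a' b' c') H b c b' c'.
  rewrite SE -sumrMnl [RHS]exchange_big; apply: eq_bigr => b' _ /=.
  under [RHS]eq_bigr do rewrite big_mkcond.
  rewrite [RHS]exchange_big big_mkcond -sumrMnl; apply: eq_bigr => c' _ /=.
  rewrite -big_mkcond /D; case: asboolP => h; last by rewrite mul0rn big_pred0 // => a'; rewrite andbF.
  rewrite sumr_const /=; congr (_ *+ _).
  rewrite /R -(card_sq hX hS x0 (nb_sym hX nab) (sq_left h)); apply: eq_card => a'.
  by rewrite !unfold_in /= andbT; apply: asbool_equiv_eq; split; apply: sq_swap.
have ac : S (glue i a c) *+ R n =
    \sum_(a' : ff) \sum_(b' : ff) \sum_(c' : ff | D a' b' c') H a c a' c'.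
  rewrite SE -sumrMnl; apply: eq_bigr => a' _; rewrite big_mkcond -sumrMnl.
  under [RHS]eq_bigr do rewrite big_mkcond.
  rewrite [RHS]exchange_big; apply: eq_bigr => c' _ /=; rewrite -big_mkcond.
  case: asboolP => h.
    rewrite sumr_const /R -(card_sq hX hS x0 nab (sq_left h)); congr (_ *+ _).
    apply: eq_card => b'; rewrite !unfold_in /= /D.
    apply/asboolP/andP => [h1|[/asboolP //]]; split; first exact/asboolP.
    exact/asboolP/(nb_trans hX (sq_swap h1) h).
  rewrite mul0rn big_pred0 // => b'; apply/negP => /andP[/asboolP h1 /asboolP h2].
  exact/h/(nb_trans hX h1 h2).
have E0 : (S (glue i a c) - (S (glue i a b) + S (glue i b c))) *+ R n = 0.
  rewrite mulrnBl mulrnDl ab bc ac -big_split -sumrB big1 // => a' _ /=.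
  rewrite -big_split -sumrB big1 // => b' _ /=.
  rewrite -big_split -sumrB big1 // => c' /andP[/asboolP h1 /asboolP h2] /=.
  by rewrite /H !glue_comm (Fadd _ _ _ h1 h2) subrr.
apply/eqP; rewrite -subr_eq0; apply/eqP; apply: (@coprime_torsion _ _ (R n) m) => //.
  exact: (coprime_sq_count hX hS x0 n com).
have Sm g : S g *+ m = 0 by rewrite -sumrMnl big1.
by rewrite mulrnBl mulrnDl !Sm addr0 subrr.
Qed.

Lemma average_cocycle n (F : (dcube n.+1 -> T) -> A) r :
  (forall e, F e *+ m = 0) -> @cocycle X A n.+1 F ->
  @cocycle X A n (fun g =>
    (\sum_(e : {ffun dcube n -> T} | `[< nbX g e >]) F (glue ord0 g e)) *+ r).
Proof.
case: n F => [//|n] F Fm Fco i a b c nab nbc; rewrite -mulrnDl; congr (_ *+ _).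
exact: (@average_additive _ i F a b c Fm (Fco (lift ord0 i)) nab nbc).
Qed.

(** If [a] and [b] are neighbours, they have the same neighbours [e], and [F] of the pair [a, b] is
    [F] of [a, e] minus [F] of [b, e]. Averaging over [e] exhibits [F] as the difference of a
    cocycle of dimension one less, to which the induction applies. *)
Lemma cocycle_coboundary n (F : (dcube n -> T) -> A) :
  (forall c, F c *+ m = 0) -> @cocycle X A n F ->
  exists f : T -> A, (forall x, f x *+ m = 0) /\ forall c, C c -> F c = csum (f \o c).
Proof.
elim: n F => [|n IH] F Fm Fco.
  exists (fun x => F (fun _ => x)); split=> // c _; rewrite csum0 /=; congr F.
  by apply: funext => v; congr c; apply/ffunP => -[].
have [r rP] := coprime_inverse (coprime_nb_count hX hS x0 n com).
pose S c := \sum_(e : {ffun dcube n -> T} | `[< nbX c e >]) F (glue ord0 c e).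
have Sm c : S c *+ m = 0 by rewrite -sumrMnl big1.
have [||f [fm fE]] := IH (fun c => S c *+ r).
- by move=> c; rewrite mulrnAC Sm mul0rn.
- exact: average_cocycle.
exists f; split=> // c cc.
pose a := c \o ins ord0 false; pose b := c \o ins ord0 true.
have cE : c = glue ord0 a b by rewrite glue_faces.
have nab : nbX a b by rewrite /nb -cE.
rewrite cE comp_glue csum_glue -!fE; last 2 first.
- exact: (nb_right hX nab).
- exact: (nb_left hX nab).
rewrite -mulrnBl -[LHS](rP _ _ (Fm _)) mulrnA; congr (_ *+ _).
rewrite -(card_nb hX hS x0 (nb_left hX nab)) -sumr_const /S.
have -> : \sum_(e : {ffun dcube n -> T} | `[< nbX b e >]) F (glue ord0 b e) =
    \sum_(e : {ffun dcube n -> T} | `[< nbX a e >]) F (glue ord0 b e).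
  apply: eq_bigl => e; apply: asbool_equiv_eq; split; first exact: (nb_trans hX nab).
  exact: (nb_trans hX (nb_sym hX nab)).
rewrite -sumrB; apply: eq_big => // e /asboolP nae.
rewrite (Fco ord0 a b e) ?addrK //.
exact: (nb_trans hX (nb_sym hX nab)).
Qed.

End Averaging.

(** * Cocycles on a product *)

Lemma glue_setc X n (i : 'I_n.+1) b (c : dcube n.+1 -> X) :
  glue i (c \o ins i b) (c \o ins i b) = c \o setc i b.
Proof.
apply: funext => v; rewrite /glue /= -{4}(delK i v) setc_ins.
by case: ifP.
Qed.

Lemma setcC n (i j : 'I_n) b b' v : i != j -> setc i b (setc j b' v) = setc j b' (setc i b v).
Proof.
move=> ne; apply/ffunP => l; rewrite !ffunE.
by case: (eqVneq l i) => [->|//]; rewrite (negbTE ne).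
Qed.

Lemma setc_idem n (i : 'I_n) b b' v : setc i b (setc i b' v) = setc i b v.
Proof. by apply/ffunP => l; rewrite !ffunE; case: (l == i). Qed.

Lemma setc_closed X n (c : dcube n -> X) (S : pred 'I_n) :
  (forall i b v, S i -> c (setc i b v) = c v) ->
  forall s w v, all S s -> c (setcs s w v) = c v.
Proof.
move=> h; elim=> [|i s IH] w v /=.
  by move=> _; congr c; apply/ffunP => j; rewrite ffunE.
move=> /andP[Si Ss]; suff -> : setcs (i :: s) w v = setc i (w i) (setcs s w v).
  by rewrite h ?IH.
by apply/ffunP => j; rewrite !ffunE inE; case: eqP => [->|].
Qed.

Lemma setcs_all n (w v : dcube n) : setcs (enum 'I_n) w v = w.
Proof. by apply/ffunP => j; rewrite ffunE mem_enum. Qed.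

Section Product.
Variable Y : cubespace.
Hypothesis hY : is_nilspace Y.
Variables (T : finType) (C : forall n, (dcube n -> T) -> Prop).
Let X := Cubespace C.
Variable k : nat.
Hypotheses (hX : is_nilspace X) (hS : forall x y : X, nil_sim k x y -> x = y).
Variables (A : zmodType) (m : nat).
Hypothesis com : coprime #|T| m.
Variable x0 : T.

Notation nbX := (@nb X _).

Definition cocycle2 n (F : (dcube n.+1 -> Y) -> (dcube n.+1 -> T) -> A) : Prop :=
  forall i (a b c : dcube n -> Y) (a' b' c' : dcube n -> T),
    nb a b -> nb b c -> nbX a' b' -> nbX b' c' ->
    F (glue i a c) (glue i a' c') = F (glue i a b) (glue i a' b') + F (glue i b c) (glue i b' c').

Section Reduced.
Variables (n : nat) (F : (dcube n.+1 -> Y) -> (dcube n.+1 -> T) -> A).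
Hypotheses (Fco : cocycle2 F) (Fm : forall c c', F c c' *+ m = 0).
Hypothesis F0 : forall y c', C c' -> F (fun _ => y) c' = 0.

(* Two decompositions of the square with diagonal from a face of c2 to a face of c2'. *)
Lemma cocycle2_nb_invariant i (c1 : dcube n.+1 -> Y) (c2 c2' : dcube n.+1 -> T) :
  cubes Y c1 -> (forall b c', C c' -> F (c1 \o setc i b) c' = 0) ->
  nbX c2 c2' -> F c1 c2 = F c1 c2'.
Proof.
move=> cc1 h n2.
pose a := c1 \o ins i false; pose b := c1 \o ins i true.
pose a2 := c2 \o ins i false; pose b2 := c2 \o ins i true.
pose a2' := c2' \o ins i false; pose b2' := c2' \o ins i true.
have E1 : glue i a b = c1 by rewrite glue_faces.
have E2 : glue i a2 b2 = c2 by rewrite glue_faces.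
have E2' : glue i a2' b2' = c2' by rewrite glue_faces.
have nab : nb a b by apply/(nbE hY i); rewrite E1.
have na : nb a a by apply/(nb_refl hY)/(nb_left hY nab).
have nb_ : nb b b by apply/(nb_refl hY)/(nb_right hY nab).
have hsq : sq C a2 b2 a2' b2' by apply/(sq_nb hX i); rewrite E2 E2'.
have n1 : nbX a2 a2' := sq_left hX hsq.
have n3 : nbX b2 b2' := sq_right hX hsq.
have n4 : nbX a2 b2 := sq_left hX (sq_tr hX hsq).
have n5 : nbX a2' b2' := sq_right hX (sq_tr hX hsq).
have /= P1 := Fco i nab nb_ n4 n3.
have /= P2 := Fco i na nab n1 n5.
have hb c' : C c' -> F (glue i b b) c' = 0 by rewrite glue_setc; apply: h.
have ha c' : C c' -> F (glue i a a) c' = 0 by rewrite glue_setc; apply: h.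
move: P1; rewrite P2 E1 E2 E2' hb ?ha ?addr0 ?add0r; last 2 first.
- exact/(nbE hX i).
- exact/(nbE hX i).
by move->.
Qed.

(** Induction on the number of directions outside [S]. If there is none, [c1] is constant. Otherwise
    [F c1] is additive in direction [i], as [c1] has equal faces there; collapsing a further
    direction [j] enlarges [S], so by induction [cocycle2_nb_invariant] applies along [j], and
    [additive_invariant_eq0] concludes. *)
Lemma cocycle2_degenerate (S : {set 'I_n.+1}) i (c1 : dcube n.+1 -> Y) (c2 : dcube n.+1 -> T) :
  i \in S -> cubes Y c1 -> (forall j b v, j \in S -> c1 (setc j b v) = c1 v) ->
  C c2 -> F c1 c2 = 0.
Proof.
have [d] := ubnP (n.+1 - #|S|); elim: d S c1 c2 => // d IH S c1 c2 lt iS cc1 dS cc2.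
have [j jS|all] := pickP [pred j | j \notin S]; last first.
  have -> : c1 = fun _ => c1 (vertex0 _); last exact: F0.
  apply: funext => v; rewrite -(setcs_all (vertex0 _) v); apply/esym.
  apply: (@setc_closed _ _ c1 (fun j => j \in S)) => [j b w|]; first exact: dS.
  by apply/allP => j _; move/negbFE: (all j).
rewrite /= in jS; apply: (@additive_invariant_eq0 T C k hX hS A m com x0 n i) => //.
- move=> a b c nab nbc.
  have E : c1 = glue i (c1 \o ins i false) (c1 \o ins i false).
    by rewrite glue_setc; apply: funext => v; rewrite /= dS.
  have na : nb (c1 \o ins i false) (c1 \o ins i false).
    by apply: (nb_refl hY); apply: (cube_ins hY).
  by rewrite E; apply: (Fco i na na).
- move=> c c'; apply: (@cocycle2_nb_invariant j) => // b c'' cc''.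
  apply: (IH (j |: S)) => //.
  + rewrite cardsU1 jS add1n -ltnS (leq_trans _ lt) // ltnS subnS.
    rewrite prednK // subn_gt0 -[X in (_ < X)%N]card_ord -cardsT proper_card // properT.
    by apply/eqP => ST; rewrite ST inE in jS.
  + by rewrite inE iS orbT.
  + exact: cube_comp cc1 (setc_coordwise j b) _.
  move=> l b' v; rewrite !inE => /orP[/eqP ->|lS] /=; first by rewrite setc_idem.
  have jl : j != l by apply: contraNneq jS => ->.
  by rewrite (setcC _ _ _ jl) dS.
Qed.

(** As [F] vanishes on degenerate [c1], the cocycle identity collapses [c2] one direction at a time
    without changing the value. Two constant cubes are neighbours, and [F c1] is equal on
    neighbours. *)
Lemma cocycle2_const (c1 : dcube n.+1 -> Y) (c2 c2' : dcube n.+1 -> T) :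
  cubes Y c1 -> C c2 -> C c2' -> F c1 c2 = F c1 c2'.
Proof.
move=> cc1 cc2 cc2'.
have dg i (c : dcube n.+1 -> Y) b c' : cubes Y c -> C c' -> F (c \o setc i b) c' = 0.
  move=> cc; apply: (@cocycle2_degenerate [set i] i); rewrite ?inE //.
    exact: cube_comp cc (setc_coordwise i b) _.
  by move=> j b' v; rewrite inE => /eqP -> /=; rewrite setc_idem.
have inv c c' : nbX c c' -> F c1 c = F c1 c'.
  by apply: (@cocycle2_nb_invariant ord0) => // b c''; apply: dg.
have step i c : C c -> F c1 c = F c1 (c \o setc i false).
  move=> cc; pose a := c1 \o ins i false; pose b := c1 \o ins i true.
  pose a2 := c \o ins i false; pose b2 := c \o ins i true.
  have nab : nb a b by apply/(nbE hY i); rewrite glue_faces.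
  have n2 : nbX a2 b2 by apply/(@nbE X hX _ i); rewrite glue_faces.
  have := Fco i nab (nb_refl hY (nb_right hY nab)) (nb_refl hX (nb_left hX n2)) n2.
  rewrite !glue_faces !glue_setc => ->; rewrite [X in _ + X]dg ?addr0 //.
have all c : C c -> F c1 c = F c1 (fun _ => c (vertex0 _)).
  have H (s : seq 'I_n.+1) : C c -> F c1 c = F c1 (c \o setcs s (vertex0 _)).
    elim: s c => [|i s IH] c' cc'.
      by congr F; apply: funext => v /=; congr c'; apply/ffunP => j; rewrite ffunE.
    rewrite (step i) // IH; last exact: (@cube_comp X hX _ _ _ _ _ cc' (setc_coordwise i false)).
    congr F; apply: funext => v /=; congr c'; apply/ffunP => j; rewrite !ffunE inE.
    by case: eqP.
  move=> cc; rewrite (H (enum 'I_n.+1)) //; congr F.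
  by apply: funext => v /=; rewrite setcs_all.
rewrite (all _ cc2) (all _ cc2'); apply: inv.
exact: (@cube_edge X hX).
Qed.

End Reduced.

(* Averaging over the second factor splits off the part of [F] that lives there;
   what is left is a cocycle vanishing as soon as one direction is constant in [Y]. *)
Lemma cocycle2_split n (F : (dcube n.+1 -> Y) -> (dcube n.+1 -> T) -> A) :
  cocycle2 F -> (forall c c', F c c' *+ m = 0) ->
  exists f : Y -> T -> A, (forall y x, f y x *+ m = 0) /\
    forall c1 c2 c2', cubes Y c1 -> C c2 -> C c2' ->
      F c1 c2 - csum (fun v => f (c1 v) (c2 v)) = F c1 c2' - csum (fun v => f (c1 v) (c2' v)).
Proof.
move=> Fco Fm.
have glue_same i (y : Y) : glue i (fun _ : dcube n => y) (fun _ => y) = fun _ => y.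
  by apply: funext => v; rewrite /glue; case: ifP.
have [f fP] : {f : Y -> T -> A & forall y, (forall x, f y x *+ m = 0) /\
    forall c, C c -> F (fun _ => y) c = csum (f y \o c)}.
  apply: (@choice _ _ (fun y f => (forall x, f x *+ m = 0) /\
    forall c, C c -> F (fun _ => y) c = csum (f \o c))) => y.
  apply: (@cocycle_coboundary T C k hX hS A m com x0 n.+1) => // i a b c nab nbc.
  rewrite -(glue_same i y); apply: Fco => //; apply: (nb_refl hY); exact: cube_const.
exists f; split=> [y x|c1 c2 c2' cc1 cc2 cc2']; first exact: (fP y).1.
pose G (c : dcube n.+1 -> Y) (c' : dcube n.+1 -> T) := F c c' - csum (fun v => f (c v) (c' v)).
apply: (@cocycle2_const n G) => //.
- move=> i a b c a' b' c' nab nbc nab' nbc'; rewrite /G (Fco i _ b _ _ b') //.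
  have E (a1 b1 : dcube n -> Y) (a2 b2 : dcube n -> T) :
      csum (fun v => f (glue i a1 b1 v) (glue i a2 b2 v)) =
      csum (fun v => f (a1 v) (a2 v)) - csum (fun v => f (b1 v) (b2 v)).
    rewrite -(csum_glue i); congr csum; apply: funext => v.
    by rewrite /glue; case: ifP.
  rewrite !E addrACA -opprD; congr (_ - _); by rewrite addrA subrK.
- move=> c c'; rewrite /G mulrnBl Fm sub0r -csumMn.
  have -> : (fun v => f (c v) (c' v) *+ m) = fun _ => 0.
    by apply: funext => v; rewrite (fP _).1.
  by rewrite csum_const oppr0.
- by move=> y c cc; rewrite /G (fP y).2 // subrr.
Qed.

End Product.

(** * Splitting a nilspace into two coprime factors *)

Definition prod2 (U V : cubespace) : cubespace :=
  @Cubespace (U * V) (fun n c =>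
    cubes U (fun v => (c v).1) /\ cubes V (fun v => (c v).2)).

Lemma prod2_step_left k U V : is_step_nilspace k (prod2 U V) -> is_step_nilspace k U.
Proof.
case=> hP sP; have [[u0 v0]] := nil_nonempty hP.
have cV n : cubes V (fun _ : dcube n => v0) := (@cube_const _ hP n (u0, v0)).2.
have lift n (c : dcube n -> U) : cubes U c -> cubes (prod2 U V) (fun v => (c v, v0)) by [].
have hU : is_nilspace U.
  split=> [||c|c|n c' cc'].
  - exact: (inhabits u0).
  - by move=> m n c t cc mt; case: (nil_comp hP (lift _ _ cc) mt).
  - by case: (nil_ergodic0 hP (fun v => (c v, v0))).
  - by case: (nil_ergodic1 hP (fun v => (c v, v0))).
  have [|c [[c1 _] cE]] := @nil_corner _ hP n (fun v => (c' v, v0)).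
    by move=> i; apply/lift/cc'.
  by exists (fun v => (c v).1); split=> // v /cE ->.
apply: step_sim => // x y h.
have /(sim_step hP sP)[] // : @nil_sim (prod2 U V) k (x, v0) (y, v0).
by apply: (iso_sim (X := U) (Y := prod2 U V) (f := fun u => (u, v0)) _ h) => n c /lift.
Qed.

Lemma prod2_swap U V : nil_isomorphic (prod2 U V) (prod2 V U).
Proof.
exists (fun p => (p.2, p.1)), (fun p => (p.2, p.1)).
by split=> [[]|[]|n c []|n c []].
Qed.

Lemma prod2_step_right k U V : is_step_nilspace k (prod2 U V) -> is_step_nilspace k V.
Proof. by move/(iso_step (prod2_swap U V))/prod2_step_left. Qed.

(** The factors are the images of [p] and [q], with the images of the cubes; that they are nilspaces
    follows from their product being one. The sections [r] and [s] identify the factors with the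
    images, so that their orders can be computed. *)
Lemma split_of_maps (T : finType) (C : forall n, (dcube n -> T) -> Prop) k
    (S1 S2 : Type) (p : T -> S1) (q : T -> S2) :
  is_step_nilspace k (Cubespace C) ->
  (forall x y, exists z, p z = p x /\ q z = q y) ->
  (forall x y, p x = p y -> q x = q y -> x = y) ->
  (forall n (c c' z : dcube n -> T), C n c -> C n c' ->
    p \o z = p \o c -> q \o z = q \o c' -> C n z) ->
  exists (U V : finType) (CU : forall n, (dcube n -> U) -> Prop)
         (CV : forall n, (dcube n -> V) -> Prop) (r : U -> T) (s : V -> T),
    [/\ is_step_nilspace k (Cubespace CU), is_step_nilspace k (Cubespace CV)
      & nil_isomorphic (Cubespace C) (prod2 (Cubespace CU) (Cubespace CV))] /\
    [/\ injective (p \o r), injective (q \o s), forall x, exists u, p (r u) = p x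
      & forall x, exists v, q (s v) = q x].
Proof.
move=> hX H1 H2 H3.
have [U [p' [r [rK pE]]]] := finite_quot p; have [V [q' [s [sK qE]]]] := finite_quot q.
pose CU n (c : dcube n -> U) := exists2 c0, C n c0 & c = p' \o c0.
pose CV n (c : dcube n -> V) := exists2 c0, C n c0 & c = q' \o c0.
have iso : nil_isomorphic (Cubespace C) (prod2 (Cubespace CU) (Cubespace CV)).
  apply: (@iso_of_bij (Cubespace C) (prod2 (Cubespace CU) (Cubespace CV)) (fun x => (p' x, q' x))).
  - by move=> x y [/pE h /qE h']; apply: H2.
  - move=> [u v]; have [z [/pE h /qE h']] := H1 (r u) (s v).
    by exists z; rewrite h h' rK sK.
  move=> n c; split=> [cc|[[c0 cc0 E] [c1 cc1 E']]]; first by split; exists c.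
  apply: (H3 n c0 c1) => //; apply: funext => v /=.
    exact/pE/(congr1 (fun f => f v) E).
  exact/qE/(congr1 (fun f => f v) E').
have hP := iso_step iso hX.
exists U, V, CU, CV, r, s; split.
  by split=> //; [apply: prod2_step_left hP|apply: prod2_step_right hP].
split.
- by move=> u u' /pE; rewrite !rK.
- by move=> u u' /qE; rewrite !sK.
- by move=> x; exists (p' x); apply/pE; rewrite rK.
- by move=> x; exists (q' x); apply/qE; rewrite sK.
Qed.

Lemma pnat_torsion (pi : nat_pred) (A : finZmodType) m :
  pi.-nat m -> pi.-nat #|[set a : A | a *+ m == 0]|.
Proof.
move=> pim; have gG : group_set [set a : A | a *+ m == 0].
  apply/group_setP; split=> [|a b]; first by rewrite inE FinRing.zmod1gE mul0rn.
  rewrite !inE FinRing.zmodMgE mulrnDl => /eqP -> /eqP ->.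
  by rewrite addr0.
apply/pnatP => [|p pr pd]; first by apply/card_gt0P; exists 0; rewrite inE mul0rn.
have [a aG ao] := @Cauchy A p (Group gG) pr pd.
have m0 : (0 < m)%N by case/andP: pim.
apply: (pnatP _ m0 pim) => //; rewrite -ao order_dvdn FinRing.zmodXgE.
by move: aG; rewrite inE.
Qed.

Lemma finzmod_exponent (A : finZmodType) (a : A) : a *+ #|A| = 0.
Proof.
have := @expg_cardG A [set: A]%G a (in_setT a).
by rewrite FinRing.zmodXgE cardsT.
Qed.

(** * The cocycle of the top extension *)

Section Step.
Variables (T : finType) (C : forall n, (dcube n -> T) -> Prop).
Let X := Cubespace C.
Variables (k : nat) (A : zmodType) (act : T -> A -> T).
Hypotheses (hX : is_nilspace X) (hA : @top_action X k A act).
Variables (U V : cubespace) (u : X -> U) (v : X -> V).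
Hypotheses (hU : is_nilspace U) (hV : is_nilspace V).
Hypotheses (cube_u : forall n (c : dcube n -> X), cubes X c -> cubes U (u \o c))
  (cube_v : forall n (c : dcube n -> X), cubes X c -> cubes V (v \o c))
  (cube_lift : forall n c1 c2, cubes U c1 -> cubes V c2 ->
     exists c : dcube n -> X, [/\ cubes X c, u \o c = c1 & v \o c = c2])
  (uv_sim : forall x y : X, u x = u y /\ v x = v y <-> nil_sim k x y).

Lemma lift_neighbour n (i : 'I_n.+1) (c : dcube n.+1 -> X) (a : dcube n -> X) :
  cubes X c -> cubes X a -> (forall w, nil_sim k (a w) (c (ins i false w))) ->
  exists b, cubes X (glue i a b) /\ forall w, nil_sim k (b w) (c (ins i true w)).
Proof.
move=> cc ca ac.
have [||w wi|w g _ h|d [cd dE dG]] := @extend_downset X hX n.+1 (fun w => ~~ w i)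
    (fun w y => nil_sim k y (c w)) (glue i a a).
- by move=> w w' /lecP le; apply: contra => /le.
- move=> w _; apply: (cube_comp hX ca (coordwise_comp (del_coordwise i) (meetc_coordwise w))).
  by move=> t /=; rewrite /glue; case: ifP.
- by rewrite /glue (negbTE wi) -{2}(delK i w) (negbTE wi).
- apply: (class_fibration hX) => //.
  exact: cube_comp cc (meetc_coordwise w) _.
exists (d \o ins i true); split=> [|w /=]; last exact: dG.
suff <- : d = glue i a (d \o ins i true) by [].
rewrite -{1}(glue_faces i d); congr glue; apply: funext => w /=.
by rewrite dE ?ins_same // glue_ins.
Qed.

Lemma act_uv x a : u (act x a) = u x /\ v (act x a) = v x.
Proof. by apply/uv_sim/sim_sym/(ta_sim hA). Qed.

(* A section of [X -> U * V], read as the [A]-valued coordinate it induces. *)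
Lemma coordinate_exists : exists f : X -> A, forall x a, f (act x a) = f x + a.
Proof.
pose P (p : U * V) (x : X) := u x = p.1 /\ v x = p.2.
have [x0] := nil_nonempty hX.
have [s sP] : {s : U * V -> X & forall p, (exists x, P p x) -> P p (s p)}.
  apply: (@choice _ _ (fun p x => (exists x, P p x) -> P p x)) => p.
  by case: (pselect (exists x, P p x)) => [[x px]|no]; [exists x|exists x0].
have [f fP] : {f : X -> A & forall x, act (s (u x, v x)) (f x) = x}.
  apply: (@choice _ _ (fun x a => act (s (u x, v x)) a = x)) => x.
  apply: (ta_transitive hA); apply/uv_sim.
  by have [] := sP (u x, v x) (ex_intro _ x (conj erefl erefl)).
exists f => x a; apply: (ta_free hA (x := s (u x, v x))).
rewrite (ta_actD hA) fP; have [<- <-] := act_uv x a.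
exact: fP.
Qed.

Lemma csum_shift (d : dcube k.+2 -> A) : cubes (Dspace k.+1 A) d -> csum d = 0.
Proof.
move=> /(_ id); apply; apply: coordwise_morphism => j.
by right; exists j, false => w; rewrite addbF.
Qed.

Variable f : X -> A.
Hypothesis f_act : forall x a, f (act x a) = f x + a.

Lemma sim_act n (c c' : dcube n -> X) : u \o c = u \o c' -> v \o c = v \o c' ->
  exists d : dcube n -> A, c' = fun w => act (c w) (d w).
Proof.
move=> eu ev; have [d dP] : {d : dcube n -> A & forall w, act (c w) (d w) = c' w}.
  apply: (@choice _ _ (fun w a => act (c w) a = c' w)) => w.
  apply: (ta_transitive hA); apply/uv_sim; split.
    exact: (congr1 (fun g => g w) eu).
  exact: (congr1 (fun g => g w) ev).
by exists d; apply: funext => w.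
Qed.

(** Two lifts of one cube of [U * V] differ by a cube of degree [k + 1] in [A], whose alternating
    sum is zero. This makes the cocycle [rho] well defined. *)
Lemma csum_lift (c c' : dcube k.+2 -> X) : cubes X c -> cubes X c' ->
  u \o c = u \o c' -> v \o c = v \o c' -> csum (f \o c) = csum (f \o c').
Proof.
move=> cc cc' eu ev; have [d dE] := sim_act eu ev.
move: cc'; rewrite dE => /(ta_cubes hA _ cc) /csum_shift cd.
have -> : f \o (fun w => act (c w) (d w)) = fun w => f (c w) + d w.
  by apply: funext => w /=; rewrite f_act.
by rewrite csumD cd addr0.
Qed.

Lemma defect_exists : exists rho : (dcube k.+2 -> U) -> (dcube k.+2 -> V) -> A,
  forall c : dcube k.+2 -> X, cubes X c -> rho (u \o c) (v \o c) = csum (f \o c).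
Proof.
pose P (p : (dcube k.+2 -> U) * (dcube k.+2 -> V)) (c : dcube k.+2 -> X) :=
  [/\ cubes X c, u \o c = p.1 & v \o c = p.2].
have [s sP] : {s : _ -> _ & forall p, (exists c, P p c) -> P p (s p)}.
  apply: (@choice _ _ (fun p c => (exists c, P p c) -> P p c)) => p.
  case: (pselect (exists c, P p c)) => [[c pc]|no]; first by exists c.
  by have [x0] := nil_nonempty hX; exists (fun _ => x0).
exists (fun c1 c2 => csum (f \o s (c1, c2))) => c cc.
have [] := sP (u \o c, v \o c); first by exists c.
by move=> cs us vs; apply: csum_lift.
Qed.

Lemma defect_cocycle rho :
  (forall c : dcube k.+2 -> X, cubes X c -> rho (u \o c) (v \o c) = csum (f \o c)) ->
  forall i (a b c : dcube k.+1 -> U) (a' b' c' : dcube k.+1 -> V),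
    nb a b -> nb b c -> nb a' b' -> nb b' c' ->
    rho (glue i a c) (glue i a' c') = rho (glue i a b) (glue i a' b') + rho (glue i b c) (glue i b' c').
Proof.
move=> rhoE i a b c a' b' c' /(nbE hU i) nab /(nbE hU i) nbc /(nbE hV i) nab' /(nbE hV i) nbc'.
have faces S (h : X -> S) (L : dcube k.+2 -> X) (g g' : dcube k.+1 -> S) : h \o L = glue i g g' ->
    h \o (L \o ins i false) = g /\ h \o (L \o ins i true) = g'.
  move=> E; have Ew w : h (L w) = glue i g g' w by rewrite -E.
  by split; apply: funext => w /=; rewrite Ew glue_ins.
have [L [cL uL vL]] := cube_lift nab nab'; have [M [cM uM vM]] := cube_lift nbc nbc'.
have [uL0 uL1] := faces _ _ _ _ _ uL; have [vL0 vL1] := faces _ _ _ _ _ vL.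
have [uM0 uM1] := faces _ _ _ _ _ uM; have [vM0 vM1] := faces _ _ _ _ _ vM.
have cB := cube_ins hX i true cL.
(* The lifts [L] and [M] agree on the common face only modulo [~_k]. The far face of [M] is
   therefore replaced by a lift [D] adjacent to the actual face of [L]. *)
have [|D [cBD DM]] := @lift_neighbour _ i M _ cM cB.
  move=> w; apply/uv_sim; split.
    by rewrite -[LHS]/((u \o (L \o ins i true)) w) uL1 -uM0.
  by rewrite -[LHS]/((v \o (L \o ins i true)) w) vL1 -vM0.
have uD : u \o D = c.
  by rewrite -uM1; apply: funext => w; case/uv_sim: (DM w).
have vD : v \o D = c'.
  by rewrite -vM1; apply: funext => w; case/uv_sim: (DM w).
have cAB : cubes X (glue i (L \o ins i false) (L \o ins i true)) by rewrite glue_faces.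
have cAD : cubes X (glue i (L \o ins i false) D).
  by apply/(nbE hX i)/(nb_trans hX (b := L \o ins i true)); apply/(nbE hX i).
move: (rhoE _ cAB) (rhoE _ cBD) (rhoE _ cAD).
rewrite !comp_glue uL0 uL1 vL0 vL1 uD vD => -> -> ->.
by rewrite !csum_glue addrA subrK.
Qed.

End Step.

(** Multiplication by [e] and by [e'] projects the [pq]-torsion onto the [p]-torsion and the
    [q]-torsion. Being given by integers, these projections commute with [csum]. *)
Lemma coprime_idempotents p q : coprime p q -> exists e e',
  forall (A : zmodType) (a : A), a *+ (p * q) = 0 ->
    [/\ a *+ e *+ p = 0, a *+ e' *+ q = 0 & a *+ e + a *+ e' = a] /\
    ((a *+ p = 0 -> a *+ e = a /\ a *+ e' = 0) /\ (a *+ q = 0 -> a *+ e' = a /\ a *+ e = 0)).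
Proof.
move=> co; have coC : coprime q p by rewrite coprime_sym.
have [r rP] := coprime_inverse coC; have [r' rP'] := coprime_inverse co.
exists (q * r)%N, (p * r')%N => A a apq.
have ap : a *+ p *+ q = 0 by rewrite -mulrnA.
have aq : a *+ q *+ p = 0 by rewrite mulrnAC.
have e1 : a *+ (q * r) *+ p = 0 by rewrite mulrnA (mulrnAC _ r) aq mul0rn.
have e2 : a *+ (p * r') *+ q = 0 by rewrite mulrnA (mulrnAC _ r') ap mul0rn.
split; last first.
  split=> h; split; first exact: rP.
  - by rewrite mulrnA h mul0rn.
  - exact: rP'.
  - by rewrite mulrnA h mul0rn.
split=> //; apply/eqP; rewrite -subr_eq0; apply/eqP; apply: (coprime_torsion co).
  rewrite mulrnBl mulrnDl e1 add0r mulrnAC (rP' _ _ ap).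
  by rewrite subrr.
by rewrite mulrnBl mulrnDl e2 addr0 mulrnAC (rP _ _ aq) subrr.
Qed.

Lemma split_step (pi : nat_pred) k (T U V : finType) (C : forall n, (dcube n -> T) -> Prop)
    (CU : forall n, (dcube n -> U) -> Prop) (CV : forall n, (dcube n -> V) -> Prop)
    (u : T -> U) (v : T -> V) :
  is_step_nilspace k.+1 (Cubespace C) ->
  is_step_nilspace k (Cubespace CU) -> is_step_nilspace k (Cubespace CV) ->
  pi.-nat #|U| -> pi^'.-nat #|V| ->
  (forall n (c : dcube n -> T), C n c -> CU n (u \o c)) ->
  (forall n (c : dcube n -> T), C n c -> CV n (v \o c)) ->
  (forall n c1 c2, CU n c1 -> CV n c2 -> exists c, [/\ C n c, u \o c = c1 & v \o c = c2]) ->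
  (forall x y : T, u x = u y /\ v x = v y <-> @nil_sim (Cubespace C) k x y) ->
  exists (U' V' : finType) (CU' : forall n, (dcube n -> U') -> Prop)
         (CV' : forall n, (dcube n -> V') -> Prop),
    [/\ is_step_nilspace k.+1 (Cubespace CU'), is_step_nilspace k.+1 (Cubespace CV'),
        pi.-nat #|U'|, pi^'.-nat #|V'|
      & nil_isomorphic (Cubespace C) (prod2 (Cubespace CU') (Cubespace CV'))].
Proof.
set X := Cubespace C => hX hU hV piU piV cu cv lift uv_sim.
pose XU := Cubespace CU; pose XV := Cubespace CV.
have [A [act hA]] := top_action_exists hX.
have hX1 := hX.1; have hU1 := hU.1; have hV1 := hV.1.
have [f f_act] := coordinate_exists (U := XU) (V := XV) (u := u) (v := v) hX1 hA uv_sim.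
have [rho rhoE] := defect_exists (U := XU) (V := XV) (u := u) (v := v) hX1 hA uv_sim f_act.
have rho_co := defect_cocycle (U := XU) (V := XV) (u := u) (v := v) hX1 hU1 hV1 lift uv_sim rhoE.
have [u0] := nil_nonempty hU1; have [v0] := nil_nonempty hV1.
pose N := #|A|; pose p := (N`_pi)%N; pose q := (N`_pi^')%N.
have N0 : (0 < N)%N by apply/card_gt0P; exists 0.
have pqN : (p * q)%N = N by apply: partnC.
have [e [e' eP]] := coprime_idempotents (coprime_partC pi N N : coprime p q).
have {}eP (a : A) := eP A a (etrans (congr1 (GRing.natmul a) pqN) (finzmod_exponent a)).
have coV : coprime #|V| p by rewrite coprime_sym; apply: pnat_coprime (part_pnat _ _) piV.
have coU : coprime #|U| q by apply: pnat_coprime piU (part_pnat _ _).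
have [f1 [f1p f1E]] : exists f1 : U -> V -> A, (forall y x, f1 y x *+ p = 0) /\
    forall c1 c2 c2', CU k.+2 c1 -> CV k.+2 c2 -> CV k.+2 c2' ->
      rho c1 c2 *+ e - csum (fun w => f1 (c1 w) (c2 w)) =
      rho c1 c2' *+ e - csum (fun w => f1 (c1 w) (c2' w)).
  apply: (@cocycle2_split (Cubespace CU) hU1 V CV k hV1 _ A p coV v0 k.+1
    (fun c1 c2 => rho c1 c2 *+ e)).
  - by move=> x y; apply: (sim_step hV1 hV.2 x y).1.
  - by move=> i a b c a' b' c' h1 h2 h3 h4; rewrite (rho_co i a b c a' b' c') // mulrnDl.
  - by move=> c c'; case: (eP (rho c c')) => -[].
have [f2 [f2q f2E]] : exists f2 : V -> U -> A, (forall y x, f2 y x *+ q = 0) /\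
    forall c2 c1 c1', CV k.+2 c2 -> CU k.+2 c1 -> CU k.+2 c1' ->
      rho c1 c2 *+ e' - csum (fun w => f2 (c2 w) (c1 w)) =
      rho c1' c2 *+ e' - csum (fun w => f2 (c2 w) (c1' w)).
  apply: (@cocycle2_split (Cubespace CV) hV1 U CU k hU1 _ A q coU u0 k.+1
    (fun c2 c1 => rho c1 c2 *+ e')).
  - by move=> x y; apply: (sim_step hU1 hU.2 x y).1.
  - by move=> i a b c a' b' c' h1 h2 h3 h4; rewrite (rho_co i a' b' c' a b c) // mulrnDl.
  - by move=> c c'; case: (eP (rho c' c)) => -[].
(* The two parts of the coordinate [f], corrected so that the alternating sum of [g1] over a cube
   depends only on its image in [U], and that of [g2] only on its image in [V]. *)
pose g1 x := f x *+ e - f1 (u x) (v x); pose g2 x := f x *+ e' - f2 (v x) (u x).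
have g1p x : g1 x *+ p = 0 by rewrite mulrnBl f1p subr0; case: (eP (f x)) => -[].
have g2q x : g2 x *+ q = 0 by rewrite mulrnBl f2q subr0; case: (eP (f x)) => -[].
have uvact := act_uv (U := XU) (V := XV) (u := u) (v := v) hA uv_sim.
have g1act x a : g1 (act x a) = g1 x + a *+ e.
  by rewrite /g1 f_act mulrnDl; case: (uvact x a) => -> ->; rewrite addrAC.
have g2act x a : g2 (act x a) = g2 x + a *+ e'.
  by rewrite /g2 f_act mulrnDl; case: (uvact x a) => -> ->; rewrite addrAC.
have surj a b : exists x, u x = a /\ v x = b.
  have [c [_ uc vc]] := lift 0%N (fun _ => a) (fun _ => b)
    (@cube_const _ hU1 0 a) (@cube_const _ hV1 0 b).
  exists (c (vertex0 0)); split; first exact: (congr1 (fun g => g (vertex0 0)) uc).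
  exact: (congr1 (fun g => g (vertex0 0)) vc).
have csum_g1 (c c' : dcube k.+2 -> T) : C k.+2 c -> C k.+2 c' -> u \o c = u \o c' ->
    csum (g1 \o c) = csum (g1 \o c').
  have E (d : dcube k.+2 -> T) : C k.+2 d -> csum (g1 \o d) =
      rho (u \o d) (v \o d) *+ e - csum (fun w => f1 (u (d w)) (v (d w))).
    by move=> cd; rewrite rhoE // -csumMn -csumB.
  move=> cc cc' eu; rewrite !E // -eu (f1E _ _ (v \o c')); [|exact: cu|exact: cv..].
  by congr (_ - csum _); apply: funext => w; rewrite -[u (c' w)]/((u \o c') w) -eu.
have csum_g2 (c c' : dcube k.+2 -> T) : C k.+2 c -> C k.+2 c' -> v \o c = v \o c' ->
    csum (g2 \o c) = csum (g2 \o c').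
  have E (d : dcube k.+2 -> T) : C k.+2 d -> csum (g2 \o d) =
      rho (u \o d) (v \o d) *+ e' - csum (fun w => f2 (v (d w)) (u (d w))).
    by move=> cd; rewrite rhoE // -csumMn -csumB.
  move=> cc cc' ev; rewrite !E // -ev (f2E _ _ (u \o c')); [|exact: cv|exact: cu..].
  by congr (_ - csum _); apply: funext => w; rewrite -[v (c' w)]/((v \o c') w) -ev.
have sim_actT x y : u x = u y -> v x = v y -> exists a, y = act x a.
  move=> h h'; have [a <-] := ta_transitive hA ((uv_sim x y).1 (conj h h')).
  by exists a.
pose P x := (u x, g1 x); pose Q x := (v x, g2 x).
have join a b (x : T) : a *+ p = 0 -> b *+ q = 0 -> exists z, [/\ u z = u x, v z = v x, g1 z = a & g2 z = b].
  move=> ap bq; pose d1 := a - g1 x; pose d2 := b - g2 x.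
  have d1p : d1 *+ p = 0 by rewrite mulrnBl ap g1p subr0.
  have d2q : d2 *+ q = 0 by rewrite mulrnBl bq g2q subr0.
  have [_ [/(_ d1p)[d1e d1e'] _]] := eP d1; have [_ [_ /(_ d2q)[d2e' d2e]]] := eP d2.
  exists (act x (d1 + d2)); have [-> ->] := uvact x (d1 + d2).
  rewrite g1act g2act (mulrnDl e d1 d2) (mulrnDl e' d1 d2) d1e d1e' d2e d2e' addr0 add0r /d1 /d2.
  by rewrite ![g1 x + _]addrC ![g2 x + _]addrC !subrK.
have [||n c c' z cc cc' Pz Qz|U' [V' [CU' [CV' [r [s [[hU' hV' iso] [Pr Qs Psur Qsur]]]]]]]] :=
    @split_of_maps T C k.+1 _ _ P Q hX.
- move=> x y; have [z0 [uz vz]] := surj (u x) (v y).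
  have [z [h1 h2 h3 h4]] := join (g1 x) (g2 y) z0 (g1p x) (g2q y).
  by exists z; rewrite /P /Q h1 h2 h3 h4 uz vz.
- move=> x y [ux gx] [vx gx']; have [a ya] := sim_actT x y ux vx.
  move: gx gx'; rewrite ya g1act g2act => /eqP; rewrite -subr_eq0 opprD addNKr oppr_eq0 => /eqP ae.
  move/eqP; rewrite -subr_eq0 opprD addNKr oppr_eq0 => /eqP ae'.
  by have [[_ _]] := eP a; rewrite ae ae' addr0 => <- _; rewrite (ta_act0 hA).
- have at_ S (h h' : dcube n -> S) : h = h' -> forall w, h w = h' w by move=> ->.
  have uz : u \o z = u \o c by apply: funext => w; case: (at_ _ _ _ Pz w).
  have vz : v \o z = v \o c' by apply: funext => w; case: (at_ _ _ _ Qz w).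
  have g1z w : g1 (z w) = g1 (c w) by case: (at_ _ _ _ Pz w).
  have g2z w : g2 (z w) = g2 (c' w) by case: (at_ _ _ _ Qz w).
  (* [w] is a genuine cube above the images of [c] and [c'], and [z] is [w] shifted by [d].
     Comparing [g1] along [c] and [w], then [g2] along [c'] and [w], kills both parts of the
     alternating sums of [d]. *)
  have [w [cw uw vw]] := lift n _ _ (cu _ _ cc) (cv _ _ cc').
  have [d zE] : exists d : dcube n -> A, z = fun t => act (w t) (d t).
    by apply: (sim_act (U := XU) (V := XV) (u := u) (v := v) hA uv_sim); [rewrite uw|rewrite vw].
  rewrite zE; apply/(ta_cubes hA d cw) => theta mt.
  have cwt : C k.+2 (w \o theta) := nil_comp hX1 cw mt.
  have cct : C k.+2 (c \o theta) := nil_comp hX1 cc mt.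
  have cct' : C k.+2 (c' \o theta) := nil_comp hX1 cc' mt.
  have E1 : csum (d \o theta) *+ e = 0.
    rewrite -csumMn; have -> : (fun t => (d \o theta) t *+ e) =
        fun t => (g1 \o (c \o theta)) t - (g1 \o (w \o theta)) t.
      by apply: funext => t /=; rewrite -g1z zE g1act addrC addKr.
    rewrite csumB (csum_g1 _ (w \o theta)) ?subrr //.
    by apply: funext => t; rewrite /= -[u (c _)]/((u \o c) _) -uw.
  have E2 : csum (d \o theta) *+ e' = 0.
    rewrite -csumMn; have -> : (fun t => (d \o theta) t *+ e') =
        fun t => (g2 \o (c' \o theta)) t - (g2 \o (w \o theta)) t.
      by apply: funext => t /=; rewrite -g2z zE g2act addrC addKr.
    rewrite csumB (csum_g2 _ (w \o theta)) ?subrr //.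
    by apply: funext => t; rewrite /= -[v (c' _)]/((v \o c') _) -vw.
  have [[_ _ E] _] := eP (csum (d \o theta)).
  by rewrite -[LHS]E E1 E2 addr0.
exists U', V', CU', CV'; split=> //.
(* The image of [P] is the product of [U] and the [p]-torsion of [A]. *)
- suff -> : #|U'| = (#|U| * #|[set a : A | a *+ p == 0%R]|)%N.
    by rewrite pnatM piU pnat_torsion // part_pnat.
  rewrite -cardsT -[#|U|]cardsT -cardsX -(card_imset _ Pr); apply: eq_card => -[a b].
  rewrite !inE /=; apply/imsetP/idP => [[x _ [_ ->]]|/eqP bp]; first by rewrite g1p.
  have [x [ux _]] := surj a v0.
  have [z [uz _ gz _]] := join b 0 x bp (mul0rn _ _).
  by have [t Pt] := Psur z; exists t; rewrite //= Pt /P uz ux gz.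
- suff -> : #|V'| = (#|V| * #|[set a : A | a *+ q == 0%R]|)%N.
    by rewrite pnatM piV pnat_torsion // part_pnat.
  rewrite -cardsT -[#|V|]cardsT -cardsX -(card_imset _ Qs); apply: eq_card => -[a b].
  rewrite !inE /=; apply/imsetP/idP => [[x _ [_ ->]]|/eqP bq]; first by rewrite g2q.
  have [x [_ vx]] := surj u0 a.
  have [z [_ vz _ gz]] := join 0 b x (mul0rn _ _) bq.
  by have [t Qt] := Qsur z; exists t; rewrite //= Qt /Q vz vx gz.
Qed.

Theorem split_coprime (pi : nat_pred) k (T : finType) (C : forall n, (dcube n -> T) -> Prop) :
  is_step_nilspace k (Cubespace C) ->
  exists (U V : finType) (CU : forall n, (dcube n -> U) -> Prop)
         (CV : forall n, (dcube n -> V) -> Prop),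
    [/\ is_step_nilspace k (Cubespace CU), is_step_nilspace k (Cubespace CV),
        pi.-nat #|U|, pi^'.-nat #|V|
      & nil_isomorphic (Cubespace C) (prod2 (Cubespace CU) (Cubespace CV))].
Proof.
elim: k T C => [|k IH] T C hX.
  (* [~_0] relates all points, so a 0-step nilspace is a single point; constant maps split it. *)
  have one x y : x = y :> T by apply: (sim_step hX.1 hX.2 x y).1; apply: sim0 hX.1 _ _.
  have [x0] := nil_nonempty hX.1.
  have [||n c c' z _ _ _ _|U [V [CU [CV [r [s [[hU hV iso] [rI sI rS sS]]]]]]]] :=
      @split_of_maps T C 0 unit unit (fun _ => tt) (fun _ => tt) hX.
  - by move=> x y; exists x.
  - by move=> x y _ _; apply: one.
  - suff -> : z = fun _ => x0 by apply: (cube_const hX.1).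
    by apply: funext => w; apply: one.
  exists U, V, CU, CV; split=> //.
    have [a0 _] := rS x0; suff -> : #|U| = 1%N by [].
    by apply/eqP/fintype1P; exists a0 => a; apply: rI.
  have [a0 _] := sS x0; suff -> : #|V| = 1%N by [].
  by apply/eqP/fintype1P; exists a0 => a; apply: sI.
have hF := factor_step hX.1 k.
have [T' [C' iso']] := @finite_model T (factor (Cubespace C) k) (@nil_class (Cubespace C) k)
   (@nil_class_surj (Cubespace C) k).
have [U [V [CU [CV [hU hV piU piV iso'']]]]] := IH T' C' (iso_step iso' hF).
have [g [h [K K' mg mh]]] := iso_trans iso' iso''.
pose cl := @nil_class (Cubespace C) k.
apply: (@split_step pi k T U V C CU CV (fun x => (g (cl x)).1) (fun x => (g (cl x)).2)) => //.
- by move=> n c cc; case: (mg n _ (@factor_cube (Cubespace C) k n c cc)).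
- by move=> n c cc; case: (mg n _ (@factor_cube (Cubespace C) k n c cc)).
- move=> n c1 c2 cc1 cc2; have [c cc E] := mh n (fun w => (c1 w, c2 w)) (conj cc1 cc2).
  have Ew w : cl (c w) = h (c1 w, c2 w) by move: (congr1 (fun t => t w) E).
  by exists c; split=> //; apply: funext => w /=; rewrite Ew K'.
move=> x y; rewrite -(nil_classE hX.1); split=> [[E1 E2]|E]; last by rewrite /cl E.
by apply: (can_inj K); rewrite -/cl [LHS]surjective_pairing E1 E2 -surjective_pairing.
Qed.

(** * Finite p-nilspaces *)

Lemma iso_simE (X Y : cubespace) (g : X -> Y) (h : Y -> X) i x y :
  cancel g h -> nil_morphism g -> nil_morphism h ->
  nil_sim i (g x) (g y) <-> nil_sim i x y.
Proof.
move=> K mg mh; split=> [/(iso_sim mh)|]; last exact: iso_sim.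
by rewrite !K.
Qed.

Lemma structure_group_of_model (X : cubespace) i (T : finType)
    (C : forall n, (dcube n -> T) -> Prop) (A : zmodType) (act : T -> A -> T) :
  is_nilspace X -> nil_isomorphic (factor X i.+1) (Cubespace C) ->
  @top_action (Cubespace C) i A act ->
  exists act' : factor X i.+1 -> A -> factor X i.+1, is_structure_group act'.
Proof.
move=> hX [g [h [K K' mg mh]]] hA.
have simE z w : nil_sim i z w <-> @nil_sim (Cubespace C) i (g z) (g w).
  by rewrite (iso_simE i z w K mg mh).
have projE (z w : factor X i.+1) : factor_proj i z = factor_proj i w <-> nil_sim i z w.
  by apply: (factor_proj_sim hX); apply: leqnSn.
exists (fun z a => h (act (g z) a)); split=> [x|x a b|x a|x y|n c c' d cc fib c'E].
- by rewrite (ta_act0 hA) K.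
- by rewrite K' (ta_actD hA).
- by apply/projE/simE; rewrite K'; apply/sim_sym/(ta_sim hA).
- move=> /projE/simE/(ta_transitive hA) [a aE]; exists a; split; first by rewrite aE K.
  move=> b bE; apply: (ta_free hA (x := g x)).
  by rewrite aE -bE K'.
have gc' : g \o c' = fun v => act (g (c v)) (d v).
  by apply: funext => v /=; rewrite c'E K'.
have cE : cubes (factor X i.+1) c' <-> C n (g \o c').
  have E : h \o (g \o c') = c' by apply: funext => v /=; rewrite K.
  by split=> [|/mh]; [exact: mg|rewrite E].
rewrite cE gc'; exact: (ta_cubes hA d (mg _ _ cc)).
Qed.

(** The order of the structure group of index [i + 1] is the size of a class of [~_i] in [X_(i+1)].
    It divides the order of [X_(i+1)], which divides that of [X], the fibres being classes of one
    size. *)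
Lemma pnat_step_pnilspace k p (T : finType) (C : forall n, (dcube n -> T) -> Prop) :
  prime p -> p.-nat #|T| -> is_step_nilspace k (Cubespace C) ->
  is_step_pnilspace k p (Cubespace C).
Proof.
set X := Cubespace C => pr pT hX; split=> // -[//|i] /andP[_ ik].
have [hX1 sX] := hX; have hS x y : @nil_sim X k x y -> x = y by move/(sim_step hX1 sX).
have [T' [C' iso]] := @finite_model T (factor X i.+1) (@nil_class X i.+1) (@nil_class_surj X i.+1).
have hF := iso_step iso (factor_step hX1 i.+1).
have hF1 := hF.1.
have hS' x y : @nil_sim (Cubespace C') i.+1 x y -> x = y by move/(sim_step hF1 hF.2).
have [A [act hA]] := top_action_exists hF.
have [act' hA'] := structure_group_of_model hX1 iso hA.
exists A, act'; split=> // a.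
have [g [h [K K' mg mh]]] := iso.
have [x0] := nil_nonempty hX1.
have dvdT' : (#|T'| %| #|T|)%N.
  have -> : #|T| = (#|T'| * class_size C i.+1 x0)%N.
    rewrite -[LHS]sum1_card (partition_big (fun x => g (nil_class i.+1 x : factor X i.+1)) predT) //=.
    rewrite -sum_nat_const; apply: eq_bigr => y _.
    have [x xE] := nil_class_surj (h y).
    rewrite (class_size_uniform hX1 hS i.+1 x0 x) sum1_card; apply: eq_card => z.
    rewrite !unfold_in /=; apply/eqP/asboolP => [E|/(nil_classE hX1) E].
      by apply/(nil_classE hX1); rewrite xE -E K.
    by rewrite -E xE K'.
  exact: dvdn_mulr.
have cardA : #|A| = class_size C' i (g (nil_class i.+1 x0 : factor X i.+1)).
  set z := g _; rewrite -(card_image (f := act z)); last exact: (ta_free hA).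
  apply: eq_card => y; rewrite [RHS]unfold_in; apply/imageP/asboolP.
    by move=> [b _ ->]; apply: (ta_sim hA).
  by move=> /(ta_transitive hA) [b <-]; exists b.
have pA : p.-nat #|A|.
  apply: pnat_dvd pT; apply: dvdn_trans dvdT'; rewrite cardA.
  exact: (class_size_dvd hF1 hS').
have [n nE] := p_natP pA; exists n; rewrite -nE.
exact: finzmod_exponent.
Qed.

(* The group law is transported to [B] in order to apply Cauchy's theorem. *)
Lemma finite_pgroup_card (A : zmodType) (B : finType) (f : A -> B) (g : B -> A) p :
  prime p -> cancel f g -> cancel g f -> is_pgroup p A -> p.-nat #|B|.
Proof.
move=> pr K K' pA.
pose add a b := f (g a + g b); pose opp a := f (- g a).
have addA : associative add by move=> a b c; rewrite /add !K addrA.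
have addC : commutative add by move=> a b; rewrite /add addrC.
have add0 : left_id (f 0) add by move=> a; rewrite /add K add0r.
have addN : left_inverse (f 0) opp add by move=> a; rewrite /add /opp K addNr.
pose G := HB.pack_for finZmodType B (GRing.isZmodule.Build B addA addC add0 addN).
have gM (a : G) n : g (a *+ n) = g a *+ n.
  elim: n => [|n IH]; first exact: K.
  rewrite !mulrS -IH; exact: K.
apply/pnatP => [|q prq]; first by apply/card_gt0P; exists (f 0).
have -> : #|B| = #|[set: G]%G|.
  rewrite (cardsT G).
  exact: (@bij_eq_card B G id (Bijective (fun _ => erefl) (fun _ => erefl))).
move=> qd; have [a _ ao] := @Cauchy G q [set: G]%G prq qd.
have [n an] := pA (g a).
have : (q %| p ^ n)%N.
  rewrite -ao order_dvdn FinRing.zmodXgE; apply/eqP; apply: (can_inj K').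
  by rewrite gM an; apply/esym/K.
by rewrite inE Euclid_dvdX // dvdn_prime2 // => /andP[].
Qed.

(** A class of [~_i] consists of as many classes of [~_(i+1)] as the structure group of index
    [i + 1] has elements. Starting from [~_k], whose classes are points, this reaches [~_0], whose
    only class is the whole space. *)
Lemma step_pnilspace_card k p (X : cubespace) (T : finType) (C : forall n, (dcube n -> T) -> Prop) :
  prime p -> nil_isomorphic X (Cubespace C) -> is_step_pnilspace k p X -> p.-nat #|T|.
Proof.
move=> pr iso [hX hp]; have hT := iso_step iso hX; have [hX1 _] := hX; have [hT1 sT] := hT.
have hS x y : @nil_sim (Cubespace C) k x y -> x = y by move/(sim_step hT1 sT).
have [h [g [K' K mh mg]]] := iso.
have simE i x y : nil_sim i (g x) (g y) <-> @nil_sim (Cubespace C) i x y.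
  exact: iso_simE.
have [x0] := nil_nonempty hT1.
suff H d i : (d + i)%N = k -> p.-nat (class_size C i x0).
  have -> : #|T| = class_size C 0 x0; last exact: (H k 0%N (addn0 k)).
  by apply/esym/eq_card => y; rewrite !unfold_in; apply/asboolP/(sim0 hT1).
elim: d i => [|d IH] i dE.
  rewrite (_ : class_size C i x0 = 1%N) // -(card1 x0); apply: eq_card => y.
  rewrite !unfold_in; apply/asboolP/eqP => [h'|->]; last exact: sim_refl.
  by apply/esym/hS; rewrite -dE.
have ik : (1 <= i.+1 <= k)%N by rewrite -dE addSnnS leq_addl.
have [A [act [hA pA]]] := hp i.+1 ik.
pose cl (t : T) : factor X i.+1 := nil_class i.+1 (g t).
have clE t t' : cl t = cl t' <-> @nil_sim (Cubespace C) i.+1 t t'.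
  by rewrite /cl (nil_classE hX1) simE.
have projE t t' : factor_proj i (cl t) = factor_proj i (cl t') <-> @nil_sim (Cubespace C) i t t'.
  by rewrite (factor_proj_sim hX1) // /cl (factor_sim hX1) // simE.
(* [delta t] is the group element moving the class of [x0] to that of [t]; the value [0] away from
   the [~_i]-class of [x0] is a dummy. Its image, all of [A], yields the finite copy [B] of the
   group. *)
have [delta deltaP] : {delta : T -> A & forall t, @nil_sim (Cubespace C) i x0 t ->
    act (cl x0) (delta t) = cl t}.
  apply: (@choice _ _ (fun t a => @nil_sim (Cubespace C) i x0 t -> act (cl x0) a = cl t)) => t.
  case: (pselect (@nil_sim (Cubespace C) i x0 t)) => [|no]; last by exists 0.
  by move=> /projE /(sg_simply_transitive hA) [a [aE _]]; exists a.
have free a b : act (cl x0) a = act (cl x0) b -> a = b.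
  move=> E; have [c [_ cU]] := sg_simply_transitive hA (esym (sg_fibre hA (cl x0) b)).
  by rewrite -(cU a E) -(cU b erefl).
have hit a : exists t, @nil_sim (Cubespace C) i x0 t /\ delta t = a.
  have [x xE] := nil_class_surj (act (cl x0) a).
  have E : cl (h x) = act (cl x0) a by rewrite /cl K'.
  have s : @nil_sim (Cubespace C) i x0 (h x).
    by apply/projE; rewrite E; apply/esym; apply: (sg_fibre hA).
  by exists (h x); split=> //; apply: free; rewrite deltaP.
have [B [q [r [rK qE]]]] := finite_quot delta.
have [f fP] := choice hit.
have K1 : cancel (q \o f) (delta \o r).
  by move=> a /=; rewrite -[RHS](fP a).2; apply/qE; rewrite rK.
have K2 : cancel (delta \o r) (q \o f).
  by move=> b /=; rewrite -[RHS]rK; apply/qE; rewrite (fP _).2.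
have pB := finite_pgroup_card pr K1 K2 pA.
have -> : class_size C i x0 = (#|B| * class_size C i.+1 x0)%N.
  rewrite /class_size -sum1_card (partition_big q predT) //= -sum_nat_const.
  apply: eq_bigr => b _; have [s E] := fP (delta (r b)).
  rewrite -/(class_size C i.+1 x0) (class_size_uniform hT1 hS i.+1 x0 (f (delta (r b)))).
  rewrite sum1_card; apply: eq_card => y; rewrite !unfold_in /=.
  apply/andP/asboolP => [[/asboolP sy /eqP qy]|sy].
    apply/clE; rewrite -(deltaP _ s) -(deltaP _ sy) E; congr (act _ _).
    by apply/qE; rewrite rK qy.
  have sxy : @nil_sim (Cubespace C) i x0 y.
    exact: (sim_trans hT1 s (sim_le hT1 (leqnSn i) sy)).
  split; first exact/asboolP.
  rewrite -[b]rK; apply/eqP/qE; rewrite -E; apply: free.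
  by rewrite !deltaP //; apply/esym/clE.
by rewrite pnatM pB IH // addnS -addSn.
Qed.

(** * Decomposition and uniqueness *)

(** The vanishing of differences descends: if all differences over (n+2)-cubes vanish, those over
    (n+1)-cubes are equal on neighbours, and being additive they are zero by
    [additive_invariant_eq0]. Differences over edges come last. The exponent [m] may depend on [a],
    as it does in [is_pgroup]. *)
Lemma polynomial_const k l (T : finType) (C : forall n, (dcube n -> T) -> Prop)
    (A : zmodType) (d : T -> A) :
  is_step_nilspace k (Cubespace C) ->
  (forall a : A, exists2 m, coprime #|T| m & a *+ m = 0) ->
  (forall c : dcube l.+1 -> T, C l.+1 c -> csum (d \o c) = 0) ->
  forall x y, d x = d y.
Proof.
move=> [hX sX] tors h0 x y.
have hS z w : @nil_sim (Cubespace C) k z w -> z = w by move/(sim_step hX sX).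
have H j : (j <= l)%N -> forall c : dcube (l - j).+1 -> T, C (l - j).+1 c -> csum (d \o c) = 0.
  elim: j => [|j IH] jl; first by rewrite subn0.
  have {IH} := IH (ltnW jl); rewrite -(subnSK jl); set n := (l - j.+1)%N => IH c cc.
  have [m com cm] := tors (csum (d \o c)).
  apply: (@additive_invariant_eq0 T C k hX hS A m com x n ord0 (fun c => csum (d \o c))) => //.
    by move=> a b b' _ _; rewrite !comp_glue !csum_glue addrA subrK.
  move=> a b nab; apply/eqP; rewrite -subr_eq0 -(csum_glue ord0) -comp_glue.
  exact/eqP/IH.
have := H l (leqnn l); rewrite subnn => h.
have := h (glue ord0 (fun _ => x) (fun _ => y)) (@cube_edge (Cubespace C) hX 0 x y).
rewrite comp_glue csum_glue !csum0 => /eqP; rewrite subr_eq0.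
by move/eqP.
Qed.

(** By induction on [i] the image lies in one class of [~_i]. The next coordinate [d] then takes
    values in a single structure group and sends (i+2)-cubes to cubes of degree [i + 1], so its
    alternating sums over them vanish. *)
Lemma morphism_const k l p q (T : finType) (C : forall n, (dcube n -> T) -> Prop)
    (Y : cubespace) (phi : T -> Y) :
  prime q -> p != q -> p.-nat #|T| -> is_step_nilspace k (Cubespace C) ->
  is_step_pnilspace l q Y -> @nil_morphism (Cubespace C) Y phi ->
  forall x y, phi x = phi y.
Proof.
move=> prq pq pT hX [[hY sY] hq] mphi x y; have hX1 := hX.1.
suff H i : (i <= l)%N -> forall z w, nil_sim i (phi z) (phi w).
  by apply/(sim_step hY sY)/(H l (leqnn l)).
elim: i => [|i IH] il z w; first exact: sim0.
have [A [act [hA pA]]] := hq i.+1 il.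
pose cl (t : T) : factor Y i.+1 := nil_class i.+1 (phi t).
have projE t t' : factor_proj i (cl t) = factor_proj i (cl t').
  by rewrite (factor_proj_sim hY) // (factor_sim hY) //; apply: IH; apply: ltnW.
have [d dE] : {d : T -> A & forall t, act (cl z) (d t) = cl t}.
  apply: (@choice _ _ (fun t a => act (cl z) a = cl t)) => t.
  by have [a [aE _]] := sg_simply_transitive hA (projE z t); exists a.
apply/(nil_classE hY); rewrite -[LHS]/(cl z) -[RHS]/(cl w) -(dE z) -(dE w); congr (act _ _).
apply: (@polynomial_const k i.+1 T C A d) => // [a|c cc].
  have [n an] := pA a; exists (q ^ n)%N => //.
  apply: (pnat_coprime pT); rewrite pnatX; apply/orP; left.
  by rewrite pnatE // !inE eq_sym.
have cz : cubes (factor Y i.+1) (fun _ : dcube i.+2 => cl z).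
  exact/(cube_const (factor_nilspace hY i.+1)).
apply: csum_shift; apply/(sg_cubes hA cz (c' := cl \o c)).
- by move=> v; apply: projE.
- by move=> v; rewrite dE.
- exact/factor_cube/mphi.
Qed.

(* Products are indexed by all of [nat] during the recursion on the set of primes,
   with trivial factors away from it; this avoids dependent index types. *)
Definition trivial_space (X : cubespace) : Prop :=
  (exists x : X, forall y, y = x) /\ forall n (c : dcube n -> X), cubes X c.

Lemma iso_product_cons (V : cubespace) (U : cubespace) (X : cubespace) (Xp : nat -> cubespace) p :
  nil_isomorphic X (prod2 U V) -> nil_isomorphic V (prod_cubespace Xp) -> trivial_space (Xp p) ->
  nil_isomorphic X (prod_cubespace (fun q => if q == p then U else Xp q)).
Proof.
move=> isoX [g [h [K K' mg mh]]] [[t tU] tC]; apply: (iso_trans isoX).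
(* Matching on [q == p] in the return type avoids casts between factors; below, [p == p] is
   generalized together with a proof that it holds, so that the match reduces. *)
pose F (x : U * V) : prod_cubespace (fun q => if q == p then U else Xp q) :=
  fun q => match q == p as b return (if b then U else Xp q) with
           | true => x.1 | false => g x.2 q end.
apply: (@iso_of_bij (prod2 U V) _ F).
- move=> [u v] [u' v'] E.
  have Eq q : F (u, v) q = F (u', v') q by rewrite E.
  have -> : u = u'.
    by move: (Eq p); rewrite /F; case: (p == p) (eqxx p).
  suff -> : v = v' by [].
  apply: (can_inj K); apply: functional_extensionality_dep => q.
  have [->|] := eqVneq q p; first by rewrite (tU (g v p)) (tU (g v' p)).
  by move: (Eq q); rewrite /F; case: (q == p).
- move=> f.
  have [u uE] : exists u, forall v, F (u, v) p = f p.
    by rewrite /F; case: (p == p) (eqxx p) (f p) => // _ u; exists u.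
  have [w wE] : exists w : prod_cubespace Xp, forall q u v, q != p -> g v q = w q -> F (u, v) q = f q.
    have [w wE] : {w : forall q, Xp q & forall q u v, q != p -> g v q = w q -> F (u, v) q = f q}.
      have wP q : {w : Xp q | forall u v, q != p -> g v q = w -> F (u, v) q = f q}.
        rewrite /F; case E: (q == p) (f q) => fq.
          by rewrite (eqP E); exists t.
        by exists fq.
      by exists (fun q => sval (wP q)) => q; apply: (svalP (wP q)).
    by exists w.
  exists (u, h w); apply: functional_extensionality_dep => q.
  case: (pselect (q = p)) => [->|/eqP qp]; first exact: uE.
  by apply: wE => //; rewrite K'.
move=> n c; split=> [[cu cv] q /=|cF].
  rewrite /F; case: (q == p) => //.
  exact: (mg n _ cv q).
split.
  by move: (cF p); rewrite /F /=; case: (p == p) (eqxx p).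
have -> : (fun v => (c v).2) = h \o (fun v => g (c v).2) by apply: funext => v /=; rewrite K.
apply: mh => q; have [->|] := eqVneq q p; first exact: tC.
by move: (cF q); rewrite /F /=; case: (q == p).
Qed.

(** [ps] is only required to contain the prime divisors of the order: after splitting off the part
    at [p], the complement [V] has order prime to [p], and the recursion goes on with the shorter
    list. *)
Lemma prime_decomposition k (ps : seq nat) (T : finType) (C : forall n, (dcube n -> T) -> Prop) :
  uniq ps -> all prime ps -> is_step_nilspace k (Cubespace C) ->
  (forall q, prime q -> (q %| #|T|)%N -> q \in ps) ->
  exists Xp : nat -> cubespace,
    [/\ forall p, p \in ps -> is_step_pnilspace k p (Xp p),
        forall p, p \notin ps -> trivial_space (Xp p)
      & nil_isomorphic (Cubespace C) (prod_cubespace Xp)].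
Proof.
elim: ps T C => [|p ps IH] T C.
  move=> _ _ hX h; have [x0] := nil_nonempty hX.1.
  have T1 : #|T| = 1%N.
    have T0 : (0 < #|T|)%N by apply/card_gt0P; exists x0.
    apply/eqP; move: T0; rewrite leq_eqVlt eq_sym => /orP[//|lt].
    by have := h _ (pdiv_prime lt) (pdiv_dvd _).
  have one (x : T) : x = x0.
    have /fintype1P[y yE] : #|T| == 1%N by rewrite T1.
    exact: etrans (yE x) (esym (yE x0)).
  pose unit_space := @Cubespace unit (fun _ _ => True).
  exists (fun _ => unit_space); split=> // [q _|]; first by split=> //; exists tt; case.
  apply: (@iso_of_bij (Cubespace C) (prod_cubespace (fun _ : nat => unit_space)) (fun _ _ => tt)).
  - by move=> x y _; rewrite (one x) (one y).
  - by move=> f; exists x0; apply: functional_extensionality_dep => q; case: (f q).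
  - move=> n c; split=> // _.
    have -> : c = fun _ => x0 by apply: funext => v; apply: one.
    exact: (cube_const hX.1).
move=> /andP[pps ups] /andP[pp pr] hX h.
have [U [V [CU [CV [hU hV pU pV iso]]]]] := split_coprime p hX.
have cardT : #|T| = (#|U| * #|V|)%N.
  have [g [g' [K K' _ _]]] := iso.
  by rewrite -card_prod; apply: (@bij_eq_card T (U * V)%type g); exists g'.
have [|Xp [XpP XpT isoV]] := IH V CV ups pr hV.
  move=> q prq qV; have := h q prq; rewrite cardT dvdn_mull // inE => /(_ isT)/orP[/eqP qp|//].
  have V0 : (0 < #|V|)%N by case/andP: pV.
  have := pnatP _ V0 pV q prq qV; by rewrite qp !inE eqxx.
exists (fun q => if q == p then Cubespace CU else Xp q); split.
- move=> q; rewrite inE; case: (eqVneq q p) => [-> _|_ /=]; last exact: XpP.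
  exact: pnat_step_pnilspace.
- move=> q; rewrite inE negb_or => /andP[/negbTE ->]; exact: XpT.
- exact: (iso_product_cons iso isoV (XpT p pps)).
Qed.

Lemma restrict_product (n : nat) (Xp : nat -> cubespace) :
  (forall p, p \notin primes n -> trivial_space (Xp p)) ->
  nil_isomorphic (prod_cubespace Xp) (prod_cubespace (fun p : prime_divisor n => Xp (sval p))).
Proof.
move=> triv.
apply: (@iso_of_bij (prod_cubespace Xp) (prod_cubespace (fun p : prime_divisor n => Xp (sval p)))
  (fun f p => f (sval p))).
- move=> f g E; apply: functional_extensionality_dep => q.
  have [qn|/triv[[x xU] _]] := boolP (q \in primes n); last by rewrite (xU (f q)).
  exact: (congr1 (fun h : forall p : prime_divisor n, Xp (sval p) => h (exist _ q qn)) E).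
- move=> g.
  have fP q : {x : Xp q | forall qn : q \in primes n, x = g (exist _ q qn)}.
    case: (pselect (q \in primes n)) => [qn|/negP nqn]; last first.
      have [/cid[x _] _] := triv q nqn; exists x => qn.
      by rewrite qn in nqn.
    by exists (g (exist _ q qn)) => qn'; rewrite (bool_irrelevance qn qn').
  exists (fun q => sval (fP q)); apply: functional_extensionality_dep => -[q qn] /=.
  exact: (svalP (fP q)).
- move=> m c; split=> [h p|h q]; first exact: h.
  have [qn|/triv[_]] := boolP (q \in primes n); last exact.
  exact: (h (exist _ q qn)).
Qed.

(** * Uniqueness of the factors *)

Section Uniqueness.
Variables (I : eqType) (k : nat) (prm : I -> nat).
Hypotheses (prm_inj : injective prm) (prm_prime : forall i, prime (prm i)).

Definition put (X : I -> cubespace) (e : prod_cubespace X) i (x : X i) : prod_cubespace X :=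
  @dfwith I (fun j => carrier (X j)) e i x.

Lemma put_same X (e : prod_cubespace X) i (x : X i) : put e x i = x.
Proof. exact: dfwith_in. Qed.

Lemma put_other X (e : prod_cubespace X) i j (x : X i) : i != j -> put e x j = e j.
Proof. exact: dfwith_out. Qed.

(** A slice through [e] in direction [i] goes to the slice through [phi e] in the same direction:
    every other component of [phi] on it is a morphism between nilspaces for distinct primes, hence
    constant. *)
Lemma product_component_morphism (X Y : I -> cubespace) (T : finType)
    (C : forall n, (dcube n -> T) -> Prop) (phi : prod_cubespace X -> prod_cubespace Y)
    (e : prod_cubespace X) i :
  (forall i, is_step_pnilspace k (prm i) (X i)) ->
  (forall i, is_step_pnilspace k (prm i) (Y i)) ->
  nil_isomorphic (Cubespace C) (prod_cubespace X) -> nil_morphism phi ->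
  @nil_morphism (X i) (Y i) (fun x => phi (put e (i := i) x) i) /\
  forall x, phi (put e (i := i) x) = put (phi e) (i := i) (phi (put e (i := i) x) i).
Proof.
move=> hX hY [a [b [K K' ma mb]]] mphi.
have m_in : @nil_morphism (X i) (prod_cubespace X) (fun x => put e (i := i) x).
  move=> n c cc j /=; case: (eqVneq i j) => [E|ij].
    case: _ / E; suff -> : (fun v => put e (i := i) (c v) i) = c by [].
    by apply: funext => v; rewrite put_same.
  have -> : (fun v => put e (i := i) (c v) j) = fun _ => e j.
    by apply: funext => v; rewrite put_other.
  exact: (cube_const (hX j).1.1).
have m_out j : @nil_morphism (X i) (Y j) (fun x => phi (put e (i := i) x) j).
  by move=> n c cc; apply: (mphi n _ (m_in n c cc) j).
split=> [|x]; first exact: m_out.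
have surj (y : X i) : exists t, a t i = y.
  by exists (b (put e (i := i) y)); rewrite K' put_same.
(* [X i] is the image of [T] under a component of the isomorphism, hence finite, as [morphism_const]
   demands of the source. *)
have [T' [C' isoi]] := finite_model surj.
have pT' := step_pnilspace_card (prm_prime i) isoi (hX i).
have [g [h [Kg Kh mg mh]]] := isoi.
apply: functional_extensionality_dep => j; case: (eqVneq i j) => [E|ij].
  by case: _ / E; rewrite put_same.
rewrite put_other //.
have e_e : put e (i := i) (e i) = e.
  apply: functional_extensionality_dep => l; case: (eqVneq i l) => [E|il].
    by case: _ / E; rewrite put_same.
  by rewrite put_other.
rewrite -{2}e_e -[x]Kg -[e i in RHS]Kg.
apply: (@morphism_const k k (prm i) (prm j) T' C' (Y j) (fun t => phi (put e (i := i) (h t)) j)) => //.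
- by rewrite (inj_eq prm_inj).
- exact: iso_step isoi (hX i).1.
- by move=> n c /mh; apply: m_out.
Qed.

(** The isomorphism of the two products and its inverse exchange the slice through [e] with the
    slice through [phi e], so their [i]-th components restricted to these slices are mutually
    inverse. *)
Lemma pnilspace_factors_unique (X Y : I -> cubespace) (T : finType)
    (C : forall n, (dcube n -> T) -> Prop) :
  (forall i, is_step_pnilspace k (prm i) (X i)) ->
  (forall i, is_step_pnilspace k (prm i) (Y i)) ->
  is_nilspace (Cubespace C) ->
  nil_isomorphic (Cubespace C) (prod_cubespace X) ->
  nil_isomorphic (Cubespace C) (prod_cubespace Y) ->
  forall i, nil_isomorphic (X i) (Y i).
Proof.
move=> hX hY hT isoX isoY i.
have [phi [psi [K K' mphi mpsi]]] := iso_trans (iso_sym isoX) isoY.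
have [t0] := nil_nonempty hT; have [a _] := isoX.
pose e := a t0.
have [mf fE] := product_component_morphism e i hX hY isoX mphi.
have [mg gE] := product_component_morphism (phi e) i hY hX isoY mpsi.
exists (fun x => phi (put e (i := i) x) i), (fun y => psi (put (phi e) (i := i) y) i); split=> //.
- by move=> x; rewrite -fE K put_same.
- by move=> y; move: (gE y); rewrite K => <-; rewrite K' put_same.
Qed.

End Uniqueness.

Theorem theorem1p4 (k : nat) (hk : (1 <= k)%N) (T : finType)
    (C : forall n, (dcube n -> T) -> Prop)
    (hX : is_step_nilspace k (Cubespace C)) :
  (exists Xp : prime_divisor #|T| -> cubespace,
     (forall p, is_step_pnilspace k (sval p) (Xp p)) /\
     nil_isomorphic (Cubespace C) (prod_cubespace Xp)) /\
  (forall Xp Yp : prime_divisor #|T| -> cubespace,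
     (forall p, is_step_pnilspace k (sval p) (Xp p)) ->
     (forall p, is_step_pnilspace k (sval p) (Yp p)) ->
     nil_isomorphic (Cubespace C) (prod_cubespace Xp) ->
     nil_isomorphic (Cubespace C) (prod_cubespace Yp) ->
     forall p, nil_isomorphic (Xp p) (Yp p)).
Proof.
have T0 : (0 < #|T|)%N by have [x] := nil_nonempty hX.1; apply/card_gt0P; exists x.
split=> [|Xp Yp hXp hYp isoX isoY].
  have [||q prq qT|Xp [hXp triv iso]] := @prime_decomposition k (primes #|T|) T C _ _ hX.
  - exact: primes_uniq.
  - by apply/allP => q; rewrite mem_primes => /andP[].
  - by rewrite mem_primes prq T0.
  exists (fun p => Xp (sval p)); split=> [[p pT]|]; first exact: hXp.
  exact: iso_trans iso (restrict_product triv).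
apply: (@pnilspace_factors_unique (prime_divisor #|T|) k sval _ _ Xp Yp T C) => //.
- exact: val_inj.
- by case=> p; rewrite /= mem_primes => /andP[].
- exact: hX.1.
Qed.
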